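(* Let $\Gamma$ be a countable group and $\Gamma\curvearrowright\mu\Gamma$ its universal minimal flow. Then the clopen type semigroup $T(\Gamma\curvearrowright\mu\Gamma)$ is unperforated and the relation $\le$ is a partial order on it. In particular, the action $\Gamma\curvearrowright\mu\Gamma$ has dynamical comparison.
   Context: The universal minimal flow $\mu\Gamma$ is the (unique up to isomorphism) minimal compact Hausdorff $\Gamma$-flow which factors onto every minimal compact Hausdorff $\Gamma$-flow; it is a compact, Hausdorff, $0$-dimensional space (isomorphic to any minimal subflow of $\beta\Gamma$). Clopen type semigroup of an action $\alpha\colon\Gamma\curvearrowright X$ ($X$ compact Hausdorff $0$-dimensional): let $Y = X\times\mathbb N$, and let $\tilde\Gamma=\Gamma\times\mathfrak S$ ($\mathfrak S$ the permutation group of $\mathbb N$) act on $Y$ by $(\gamma,\sigma)(x,n)=(\alpha(\gamma)x,\sigma(n))$. A clopen $A\subseteq Y$ is bounded if $A\cap(X\times\{n\})=\emptyset$ for all large $n$. Bounded clopen $A,B$ are equidecomposable if there are clopen $A_1,\dots,A_n$ and $\tilde\gamma_i\in\tilde\Gamma$ with $A=\bigsqcup_i A_i$, $B=\bigsqcup_i\tilde\gamma_iA_i$. $T(\alpha)$ is the set of classes $[A]$, with $[A]+[B]=[A'\sqcup B']$ for disjoint representatives; $0=[\emptyset]$. $a\le b$ iff $b=a+c$ for some $c$. Unperforated: $na\le nb\Rightarrow a\le b$ for all $n\ge1$. Dynamical comparison: for all nonempty clopen $A,B\subseteq X$ with $\mu(A)<\mu(B)$ for every $\alpha$-invariant Radon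 probability measure $\mu$ on $X$, one has $[A\times\{0\}]\le[B\times\{0\}]$. *)

(* Defs.v *)
From HB Require Import structures.
From mathcomp Require Import all_boot all_order all_algebra.
From mathcomp Require Import all_classical all_reals all_analysis.
Set Implicit Arguments. Unset Strict Implicit. Unset Printing Implicit Defensive.
Import Order.TTheory GRing.Theory Num.Theory.
Local Open Scope classical_set_scope.

Definition is_group (G : Type) (mul : G -> G -> G) (one : G) (inv : G -> G) :=
  [/\ forall a b c, mul a (mul b c) = mul (mul a b) c,
      forall a, mul one a = a & forall a, mul (inv a) a = one].

Definition is_action (G : Type) (mul : G -> G -> G) (one : G)
    (X : topologicalType) (act : G -> X -> X) :=
  [/\ forall g, continuous (act g),
      forall x, act one x = x &
      forall g h x, act (mul g h) x = act g (act h x)].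

Definition invariant_set (G : Type) (X : Type) (act : G -> X -> X) (A : set X) :=
  forall g, act g @` A `<=` A.

Definition ch_flow (G : Type) (mul : G -> G -> G) (one : G)
    (X : topologicalType) (act : G -> X -> X) :=
  [/\ is_action mul one act, compact [set: X] & hausdorff_space X].

Definition minimal_flow (G : Type) (mul : G -> G -> G) (one : G)
    (X : topologicalType) (act : G -> X -> X) :=
  [/\ ch_flow mul one act, [set: X] !=set0 &
      forall A : set X, closed A -> invariant_set act A -> A !=set0 -> A = setT].

Definition factors_onto (G : Type) (X Y : topologicalType)
    (actX : G -> X -> X) (actY : G -> Y -> Y) :=
  exists f : X -> Y, [/\ continuous f, forall y, exists x, f x = y &
                          forall g x, f (actX g x) = actY g (f x)].

Definition universal_minimal_flow (G : Type) (mul : G -> G -> G) (one : G)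
    (X : topologicalType) (act : G -> X -> X) :=
  minimal_flow mul one act /\
  forall (Y : topologicalType) (actY : G -> Y -> Y),
    minimal_flow mul one actY -> factors_onto act actY.

(* Y = X x N, with N discrete: a set is clopen iff every slice is clopen *)
Definition clopenY (X : topologicalType) (A : set (X * nat)) :=
  forall n, clopen [set x | A (x, n)].

Definition boundedY (X : Type) (A : set (X * nat)) :=
  exists N, forall x n, A (x, n) -> (n < N)%N.

Definition bclopen (X : topologicalType) (A : set (X * nat)) :=
  clopenY A /\ boundedY A.

(* action of Gamma x Sym(N) on X x N *)
Definition tact (G : Type) (X : Type) (act : G -> X -> X)
    (g : G) (s : nat -> nat) (p : X * nat) : X * nat := (act g p.1, s p.2).

Definition equidec (G : Type) (X : topologicalType) (act : G -> X -> X)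
    (A B : set (X * nat)) :=
  [/\ bclopen A, bclopen B &
   exists n (P : 'I_n -> set (X * nat)) (g : 'I_n -> G) (s : 'I_n -> nat -> nat),
     (forall i, bijective (s i)) /\ (forall i, clopenY (P i)) /\
     [/\
         forall i j, i != j -> P i `&` P j = set0,
         forall i j, i != j -> tact act (g i) (s i) @` P i `&`
                               tact act (g j) (s j) @` P j = set0,
         A = \bigcup_i P i &
         B = \bigcup_i (tact act (g i) (s i) @` P i)]].

(* [A] + [B] = [C] : C is in the class of A' u B' for disjoint representatives *)
Definition tsum (G : Type) (X : topologicalType) (act : G -> X -> X)
    (A B C : set (X * nat)) :=
  exists A' B', [/\ equidec act A A', equidec act B B', A' `&` B' = set0 &
                    equidec act (A' `|` B') C].

Fixpoint tnsum (G : Type) (X : topologicalType) (act : G -> X -> X)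
    (n : nat) (A C : set (X * nat)) : Prop :=
  match n with
  | 0 => equidec act set0 C
  | m.+1 => exists D, tnsum act m A D /\ tsum act D A C
  end.

Definition tle (G : Type) (X : topologicalType) (act : G -> X -> X)
    (A B : set (X * nat)) :=
  [/\ bclopen A, bclopen B & exists C, bclopen C /\ tsum act A C B].

Definition unperforated (G : Type) (X : topologicalType) (act : G -> X -> X) :=
  forall (n : nat) (A B nA nB : set (X * nat)), (0 < n)%N ->
    bclopen A -> bclopen B -> tnsum act n A nA -> tnsum act n B nB ->
    tle act nA nB -> tle act A B.

Definition tle_partial_order (G : Type) (X : topologicalType) (act : G -> X -> X) :=
  [/\ forall A, bclopen A -> tle act A A,
      forall A B C, tle act A B -> tle act B C -> tle act A C &
      forall A B, tle act A B -> tle act B A -> equidec act A B].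

Definition borelT (X : ptopologicalType) := g_sigma_algebraType (@open X).

Definition radon (X : ptopologicalType) (R : realType)
    (mu : probability (borelT X) R) :=
  forall B : set (borelT X), measurable B ->
    mu B = ereal_sup [set mu K | K in [set K : set X | compact K /\ K `<=` B]] /\
    mu B = ereal_inf [set mu U | U in [set U : set X | open U /\ B `<=` U]].

Definition invariant_measure (G : Type) (X : ptopologicalType) (R : realType)
    (act : G -> X -> X) (mu : probability (borelT X) R) :=
  forall g (B : set (borelT X)), measurable B -> mu (act g @^-1` B) = mu B.

Definition dynamical_comparison (G : Type) (X : ptopologicalType) (R : realType)
    (act : G -> X -> X) :=
  forall A B : set X, clopen A -> clopen B -> A !=set0 -> B !=set0 ->
    (forall mu : probability (borelT X) R, radon mu -> invariant_measure act mu ->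
       (mu A < mu B)%E) ->
    tle act (A `*` [set 0%N]) (B `*` [set 0%N]).

(* Main.v *)
Require Import Defs.
From HB Require Import structures.
From mathcomp Require Import all_boot all_order all_algebra.
From mathcomp Require Import all_classical all_reals all_analysis.
From mathcomp Require Import finmap zify.

(** Universality, applied to a minimal subflow of the ultrafilter flow [beta Gamma],
gives an equivariant Boolean homomorphism [Phi] from the subsets of [Gamma] to the
clopen subsets of [X]. Limits along the resulting ultrafilters make [X] a compact
right-topological semigroup, and an idempotent [x0] of it satisfies
[Phi {g | g x0 in A} = A] for every clopen [A]. Hence equidecompositions of clopen
sets can be pulled back to [Gamma x N] along the orbit of [x0] and pushed forward
by [Phi]: [A <= B] in the type semigroup iff the trace of [A] injects into the trace
of [B] by a map that moves the [Gamma]-coordinate by finitely many left translations.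
For such injections antisymmetry is the Schroeder-Bernstein argument and
unperforation is Hall's theorem for infinite locally finite graphs.

For comparison, suppose that [A] does not inject into [B]. For every finite set of
translations Hall's condition fails at some finite [S]; as the trace of [B] is
syndetic, the sets [E^k S] cannot keep growing, so one of them is a Foelner set
containing at least as many points of [A] as of [B]. An ultralimit of counting
measures is an invariant mean on [Gamma], and the measure it induces on clopen sets
extends to an invariant Radon probability [mu] with [mu B <= mu A]. *)

Set Implicit Arguments. Unset Strict Implicit. Unset Printing Implicit Defensive.
Import Order.TTheory GRing.Theory Num.Theory.
Import numFieldNormedType.Exports.
Local Open Scope classical_set_scope.

Lemma clopenD (T : topologicalType) (A B : set T) :
  clopen A -> clopen B -> clopen (A `\` B).
Proof. by move=> cA cB; rewrite setDE; apply: clopenI => //; exact: (clopenC set0). Qed.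

(** * Minimal closed sets and idempotents *)

(** Zorn's lemma is applied to the open sets removed from [K]. The union of a chain of them leaves a
    nonempty set by compactness, and a maximal one leaves a minimal closed set with the property
    [P]. *)
Lemma minimal_closed (T : topologicalType) (P : set (set T)) (K : set T) :
  compact K -> closed K -> K !=set0 -> P K ->
  (forall F : set (set T), F !=set0 -> F `<=` P -> P (\bigcap_(A in F) A)) ->
  exists M, [/\ closed M, M !=set0, M `<=` K, P M &
    forall N, closed N -> N !=set0 -> N `<=` M -> P N -> N = M].
Proof.
move=> cK clK K0 PK PI.
pose Q (U : set T) := [/\ open U, K `\` U !=set0 & P (K `\` U)].
have [|U [[oU U0 PU] Umax]] := @Zorn_bigcup T Q.
  move=> F FQ Ftot; have [->|/set0P F0] := eqVneq F set0.
    by rewrite bigcup_set0; split; rewrite ?setD0//; exact: open0.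
  have eqI : K `\` \bigcup_(U in F) U = \bigcap_(A in [set K `\` U | U in F]) A.
    apply/seteqP; split=> x.
      by move=> [Kx nUx] _ [U FU <-]; split=> // Ux; apply: nUx; exists U.
    case: F0 => V FV h; split; first by have [] := h _ (imageP _ FV).
    by move=> [U FU Ux]; have [] := h _ (imageP _ FU).
  split.
  - by apply: bigcup_open => U /FQ[].
  - have FF : ProperFilter (filter_from F (fun U => K `\` U)).
      apply: filter_from_proper; last by move=> U /FQ[].
      apply: filter_from_filter => //.
      move=> U V FU FV; have [UV|VU] := Ftot _ _ FU FV.
        by exists V => // x [Kx nV]; split; split => // /UV.
      by exists U => // x [Kx nV]; split; split => // /VU.
    have [|p [Kp clp]] := cK _ FF.
      by case: F0 => U FU; exists U => // x [].
    exists p; split => // -[U FU Up].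
    have oU : open U by have [] := FQ _ FU.
    have [||x [[_ nUx] Ux]] := clp (K `\` U) U; first by exists U.
      exact: open_nbhs_nbhs.
    exact: nUx.
  - rewrite eqI; apply: PI.
      by case: F0 => U FU; exists (K `\` U); exists U.
    by move=> _ [U FU <-]; have [] := FQ _ FU.
exists (K `\` U); split => [|//||//|].
- by rewrite setDE; apply: closedI => //; exact: open_closedC.
- by move=> x [].
move=> N clN N0 NU PN.
have KN : K `\` ~` N = N.
  by rewrite setDE setCK; apply/seteqP; split=> [x []|x Nx] //; split=> //; have [] := NU _ Nx.
have QN : Q (~` N) by split; [exact: closed_openC|rewrite KN|rewrite KN].
have UN : U `<=` ~` N by move=> x Ux Nx; have [] := NU _ Nx.
have [NUe|nNU] := pselect (~` N `<=` U).
  by rewrite -{1}KN; congr (_ `\` _); apply/seteqP; split.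
by have := Umax (~` N); rewrite /proper => /(_ (conj UN nNU)).
Qed.

(* In a minimal closed subsemigroup [S], both [S s] and [{t in S | t s = s}] are closed
   subsemigroups, hence equal to [S]. *)
Lemma ellis_idempotent (T : topologicalType) (op : T -> T -> T) :
  compact [set: T] -> hausdorff_space T -> [set: T] !=set0 ->
  (forall x y z, op (op x y) z = op x (op y z)) ->
  (forall y, continuous (op^~ y)) ->
  exists e, op e e = e.
Proof.
move=> cT hT T0 opA opc.
pose P (S : set T) := forall x y, S x -> S y -> S (op x y).
have [//|F F0 FP x y Fx Fy A FA|S [clS [s Ss] _ PS Smin]] :=
    minimal_closed (P := P) cT closedT T0.
  by apply: FP => //; [exact: Fx|exact: Fy].
have cS : compact S := subclosed_compact clS cT (@subsetT _ _).
have imS : op^~ s @` S = S.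
  apply: Smin.
  - apply: compact_closed => //; apply: continuous_compact => //.
    exact/continuous_subspaceT.
  - by exists (op s s); exists s.
  - by move=> _ [x Sx <-]; exact: PS.
  - move=> _ _ [x Sx <-] [y Sy <-]; exists (op (op x s) y).
      by apply: (PS) => //; exact: PS.
    by rewrite !opA.
have stS : S `&` [set t | op t s = s] = S.
  apply: Smin.
  - apply: closedI => //; apply: (closed_comp (f := op^~ s) (D := [set s])).
      by move=> x _; exact: opc.
    exact/accessible_closed_set1/hausdorff_accessible.
  - by move: Ss; rewrite -{1}imS => -[t St ts]; exists t.
  - by move=> x [].
  - by move=> x y [Sx xs] [Sy ys]; split; [exact: PS|rewrite /= opA ys].
by exists s; move: Ss; rewrite -stS => -[].
Qed.

(** * A minimal subflow of the space of ultrafilters *)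

(** Universality quantifies over topological types, so a minimal closed invariant subset of [K] is
    made into a type of its own, with the topology induced by the inclusion. *)
Lemma exists_minimal_subflow (G : Type) (mul : G -> G -> G) (one : G)
    (W : topologicalType) (act : G -> W -> W) (K : set W) :
  is_action mul one act -> hausdorff_space W -> compact K -> closed K ->
  K !=set0 -> invariant_set act K ->
  exists (Y : topologicalType) (actY : G -> Y -> Y) (i : Y -> W),
    [/\ minimal_flow mul one actY, continuous i, forall y, K (i y) &
        forall g y, i (actY g y) = act g (i y)].
Proof.
move=> [actC act1 actM] hW cK clK K0 Kinv.
have [|M [clM M0 MK Minv Mmin]] :=
    minimal_closed (P := invariant_set act) cK clK K0 Kinv.
  move=> F F0 FP g _ [x Fx <-] A FA.
  by apply: (FP _ FA g); exists x => //; exact: Fx.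
have cM : compact M := subclosed_compact clM cK MK.
have Mact g (y : M) : act g (val y) \in M.
  by apply: mem_set; apply: (Minv g); exists (val y) => //; exact: set_valP.
pose Y : topologicalType := initial_topology (val : M -> W).
pose actY g (y : Y) : Y := SigSub (Mact g y).
have valC : continuous (val : Y -> W) by exact: initial_continuous.
have valI : injective (val : Y -> W) by exact: val_inj.
have valP (y : Y) : M (val y) by exact: set_valP.
have openY (A : set Y) : open A -> exists2 B : set W, open B & val @^-1` B = A.
  by move=> [B oB <-]; exists B.
exists Y, actY, val; split => //; last by move=> y; exact/MK/valP.
split.
- split.
  + split.
    * move=> g; apply/continuousP => A /openY[B oB <-].
      have -> : actY g @^-1` (val @^-1` B) = val @^-1` (act g @^-1` B) by [].
      exists (act g @^-1` B) => //.
      by apply: open_comp => // w _; exact: actC.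
    * by move=> y; apply: valI; rewrite /= act1.
    * by move=> g h y; apply: valI; rewrite /= actM.
  + move=> F FF _.
    have [|p [Mp clp]] := cM (val @ F) _.
      by apply: (filterE (F := F)) => y; exact: valP.
    exists (SigSub (mem_set Mp) : Y); split => // A B FA nB.
    move: nB; rewrite nbhsE => -[_ [/openY[C oC <-] /= Cp] CB].
    have [||x [[y Ay <-] Cy]] := clp ((val : Y -> W) @` A) C.
    * by apply: (filterS (F := F) _ FA) => y Ay; exists y.
    * exact: open_nbhs_nbhs.
    by exists y; split => //; exact: CB.
  + move=> p q clpq; apply: valI; apply: hW => A B nA nB.
    have [||y [Ay By]] := clpq (val @^-1` A) (val @^-1` B).
    * exact: valC.
    * exact: valC.
    by exists (val y).
- by case: M0 => m Mm; exists (SigSub (mem_set Mm)).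
(* The image of a closed invariant set is closed and invariant in [W], so minimality of [M] applies
   to it. *)
- move=> A clA Ainv [a Aa].
  have imA : val @` A = M.
    apply: Mmin.
    + have [B oB BA] : exists2 B : set W, open B & val @^-1` B = ~` A.
        exact/openY/closed_openC.
      have -> : val @` A = M `&` ~` B.
        apply/seteqP; split=> [_ [y Ay <-]|x [Mx nBx]].
          split; first exact: valP.
          by move=> By; have : (val @^-1` B) y by []; rewrite BA.
        exists (SigSub (mem_set Mx) : Y) => //.
        apply: contrapT => nA.
        by have : (~` A) (SigSub (mem_set Mx) : Y) by []; rewrite -BA.
      by apply: closedI => //; exact: open_closedC.
    + by exists (val a); exists a.
    + by move=> _ [y _ <-]; exact: valP.
    + move=> g _ [_ [y Ay <-] <-]; exists (actY g y) => //.
      by apply: (Ainv g); exists y.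
  apply/seteqP; split=> // y _.
  have : (val @` A) (val y) by rewrite imA; exact: valP.
  by move=> [z Az /valI <-].
Qed.

(** These are the ultrafilters on [T]. Seen as points of a product of two-point spaces they form a
    closed set, compact by Tychonoff's theorem. *)
Definition bool_hom (T : Type) (w : set T -> bool) :=
  [/\ w setT, forall S S', w (S `&` S') = w S && w S' &
      forall S, w (~` S) = ~~ w S].

Section BoolHomSpace.
Variable T : Type.
Let W := prod_topology (fun _ : set T => bool).

Lemma near_eval (w : W) (S : set T) : \forall w' \near w, w' S = w S.
Proof.
have := @proj_continuous (set T : eqType) (fun _ => bool) S w [set w S].
by apply.
Qed.

Lemma bool_hom_closed : closed (@bool_hom T : set W).
Proof.
move=> w clw; split.
- by have [v [[vT _ _] <-]] := clw _ (near_eval w setT).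
- move=> S S'.
  have [v [[_ vI _] [[e1 e2] e3]]] := clw _ (filterI (filterI
    (near_eval w S) (near_eval w S')) (near_eval w (S `&` S'))).
  by rewrite -e3 vI e1 e2.
- move=> S.
  have [v [[_ _ vC] [e1 e2]]] := clw _ (filterI
    (near_eval w S) (near_eval w (~` S))).
  by rewrite -e2 vC e1.
Qed.

Lemma bool_hom_compact : compact (@bool_hom T : set W).
Proof.
apply: subclosed_compact bool_hom_closed _ (@subsetT _ _).
have := @tychonoff (set T : eqType) (fun _ => bool) (fun _ => setT)
  (fun _ => bool_compact).
by congr compact; apply/seteqP; split.
Qed.

End BoolHomSpace.

(** Universality gives an equivariant map from [X] to a space of ultrafilters on [G]; [Phi S] is the
    preimage of the clopen set of ultrafilters that contain [S]. *)
Lemma ultra_coding (G : countType) (mul : G -> G -> G) (one : G) (inv : G -> G)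
    (X : topologicalType) (act : G -> X -> X) :
  is_group mul one inv -> universal_minimal_flow mul one act ->
  exists Phi : set G -> set X,
    [/\ forall S, clopen (Phi S), Phi setT = setT,
        forall S S', Phi (S `&` S') = Phi S `&` Phi S',
        forall S, Phi (~` S) = ~` Phi S &
        forall g S, Phi [set h | S (mul g h)] = act g @^-1` Phi S].
Proof.
move=> [mulA mul1 _] [_ univ].
pose W := prod_topology (fun _ : set G => bool).
(* The pushforward of an ultrafilter under left multiplication by [g]. *)
pose tr g (w : W) : W := fun S => w [set h | S (mul g h)].
have trA : is_action mul one tr.
  split.
  - move=> g w; apply/cvg_sup => S.
    move=> A; rewrite nbhsE => -[_ [[B oB <-] /= Bw] BA].
    apply: filterS (near_eval w [set h | S (mul g h)]) => w' w'E.
    by apply: BA; rewrite /= /tr w'E.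
  - move=> w; apply/funext => S; rewrite /tr; congr (w _).
    by apply/seteqP; split=> h /=; rewrite mul1.
  - move=> g h w; apply/funext => S; rewrite /tr; congr (w _).
    by apply/seteqP; split=> k /=; rewrite mulA.
have [|||Y [actY [i [minY iC Kv ieq]]]] := exists_minimal_subflow trA _
    (@bool_hom_compact G) (@bool_hom_closed G).
- by apply: hausdorff_product => S; exact: discrete_hausdorff.
(* The principal ultrafilter at [one]. *)
- exists (fun S => `[< S one >]); split.
  + exact/asboolP.
  + by move=> S S'; rewrite asbool_and.
  + by move=> S; rewrite asbool_neg.
- move=> g _ [w [wT wI wC] <-]; rewrite /tr; split.
  + exact: wT.
  + by move=> S S'; rewrite -wI.
  + by move=> S; rewrite -wC.
have [f [fC _ feq]] := univ _ _ minY.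
exists (fun S => [set x | i (f x) S]); split.
- have op b S : open [set x | i (f x) S = b].
    rewrite openE => x <-; rewrite /interior.
    have : continuous (i \o f).
      by move=> y; apply: continuous_comp; [exact: fC|exact: iC].
    by move=> /(_ x _ (near_eval (i (f x)) S)).
  move=> S; split; first exact: op.
  rewrite -openC; have := op false S; congr open.
  by apply/seteqP; split=> x /=; case: (i (f x) S).
- by apply/seteqP; split=> // x _; have [] := Kv (f x).
- move=> S S'; apply/seteqP; split=> x /=; have [_ -> _] := Kv (f x).
    by move=> /andP.
  by move=> /andP.
- move=> S; apply/seteqP; split=> x /=; have [_ _ ->] := Kv (f x).
    by move=> /negP.
  by move=> /negP.
- by move=> g S; apply/seteqP; split=> x /=; rewrite feq ieq.
Qed.

(** * The orbit of an idempotent *)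

Section SetHom.
Variables (T X : Type) (Phi : set T -> set X).
Hypothesis (PhiT : Phi setT = setT).
Hypothesis (PhiI : forall S S', Phi (S `&` S') = Phi S `&` Phi S').
Hypothesis (PhiC : forall S, Phi (~` S) = ~` Phi S).

Lemma set_hom0 : Phi set0 = set0.
Proof. by rewrite -setCT PhiC PhiT setCT. Qed.

Lemma set_hom_subset S S' : S `<=` S' -> Phi S `<=` Phi S'.
Proof. by move=> /setIidPl <-; rewrite PhiI => x []. Qed.

Lemma set_homU S S' : Phi (S `|` S') = Phi S `|` Phi S'.
Proof. by rewrite -[S `|` S']setCK setCU PhiC PhiI !PhiC setCI !setCK. Qed.

Lemma set_hom_bigcup_ord n (P : 'I_n -> set T) :
  Phi (\bigcup_i P i) = \bigcup_i Phi (P i).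
Proof.
have bigE Y (Q : 'I_n -> set Y) : \bigcup_i Q i = \big[setU/set0]_(i < n) Q i.
  rewrite -(bigcup_seq (index_enum 'I_n) Q).
  by apply/seteqP; split=> y [i _ Qi]; exists i => //=; rewrite mem_index_enum.
by rewrite !bigE; exact: (big_morph Phi set_homU set_hom0).
Qed.

Lemma set_hom_filter x : ProperFilter [set S | Phi S x].
Proof.
apply: Build_ProperFilter.
  by rewrite /= set_hom0.
split; first by rewrite /= PhiT.
- by move=> S S' PS PS'; rewrite mksetE PhiI.
- by move=> S S' /set_hom_subset; exact.
Qed.

End SetHom.

Section Retraction.
Variables (G : Type) (mul : G -> G -> G) (one : G).
Variables (X : topologicalType) (act : G -> X -> X) (Phi : set G -> set X).
Hypothesis minX : minimal_flow mul one act.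
Hypothesis Phi_clopen : forall S, clopen (Phi S).
Hypothesis PhiT : Phi setT = setT.
Hypothesis PhiI : forall S S', Phi (S `&` S') = Phi S `&` Phi S'.
Hypothesis PhiC : forall S, Phi (~` S) = ~` Phi S.
Hypothesis Phi_act : forall g S, Phi [set h | S (mul g h)] = act g @^-1` Phi S.

(* [ulim x y z]: z is the limit of g y along the ultrafilter {S | x in Phi S} on G. *)
Let ulim (x y z : X) := forall A, nbhs z A -> Phi [set g | A (act g y)] x.

(** A cluster point along an ultrafilter is a limit: by [PhiC] either a set of group elements or its
    complement belongs to the ultrafilter of [x]. *)
Let ulim_ex x y : exists z, ulim x y z.
Proof.
have [[_ cX _] _ _] := minX.
have PF := set_hom_filter PhiT PhiI PhiC x.
have [|z [_ clz]] := cX (fmap (act^~ y) [set S | Phi S x]) _; first exact: filterT.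
exists z => A nA; apply: contrapT => nPhi.
have : Phi (~` [set g | A (act g y)]) x by rewrite PhiC.
by move=> PhiCA; have [|w [nAw Aw]] := clz (~` A) A PhiCA.
Qed.

Let op x y := projT1 (cid (ulim_ex x y)).

Let opP x y : ulim x y (op x y).
Proof. exact: (projT2 (cid (ulim_ex x y))). Qed.

Let Phi_meet x S S' : Phi S x -> Phi S' x -> exists g, S g /\ S' g.
Proof.
move=> PS PS'; have PF := set_hom_filter PhiT PhiI PhiC x.
have PSS' : [set S | Phi S x] (S `&` S') by rewrite mksetE PhiI.
exact: (@filter_ex _ _ PF _ PSS').
Qed.

Let ulim_unique x y z z' : ulim x y z -> ulim x y z' -> z = z'.
Proof.
have [[_ _ hX] _ _] := minX.
move=> lz lz'; apply: hX => A B nA nB.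
have [g [Ag Bg]] := Phi_meet (lz A nA) (lz' B nB).
by exists (act g y).
Qed.

(** By [Phi_act] the ultrafilter of [act g x] is the translate by [g] of that of [x], and limits
    commute with the continuous map [act g]. *)
Let op_act g x y : op (act g x) y = act g (op x y).
Proof.
have [[[actC _ actM] _ _] _ _] := minX.
apply: (ulim_unique (@opP _ _)) => A nA.
rewrite -[Phi _ _]/((act g @^-1` Phi _) x) -Phi_act.
have -> : [set h | [set k | A (act k y)] (mul g h)] =
    [set h | (act g @^-1` A) (act h y)].
  by apply/seteqP; split=> h /=; rewrite actM.
by apply: opP; exact: actC.
Qed.

(** By regularity a neighbourhood [V] of the limit has its closure in [A]. The points whose
    ultrafilter contains the visits of [y] to [V] form a clopen set, and their limits lie in the
    closure of [V]. *)
Let op_continuous y : continuous (op^~ y).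
Proof.
have [[_ cX hX] _ _] := minX.
move=> x A nA.
have [V nV VA] := compact_regular (V := setT) hX cX (x := op x y) filterT nA.
have PV := opP nV.
have : nbhs x (Phi [set g | V (act g y)]).
  by apply: open_nbhs_nbhs; split => //; have [] := Phi_clopen [set g | V (act g y)].
apply: filterS => x' Px'; apply: VA => B nB.
have [g [Vg Bg]] := Phi_meet Px' (opP nB).
by exists (act g y).
Qed.

(** The map [op^~ z] is continuous and equivariant, so it carries the limit of the orbit of [y] to
    the limit of the orbit of [op y z]. *)
Let op_assoc x y z : op (op x y) z = op x (op y z).
Proof.
apply: (@ulim_unique x (op y z)) => // A nA.
have -> : [set g | A (act g (op y z))] = [set g | (op^~ z @^-1` A) (act g y)].
  by apply/seteqP; split=> g /=; rewrite op_act.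
by apply: opP; exact: op_continuous.
Qed.

(** Right multiplication by an idempotent [e] fixes a closed invariant set containing [e], hence
    every point. So each [x] is the limit of the orbit of [e] along the ultrafilter of [x]
    itself. *)
Lemma orbit_retraction : exists x0,
  (forall A, clopen A -> Phi [set g | A (act g x0)] = A) /\
  zero_dimensional X.
Proof.
have [[[actC act1 actM] cX hX] X0 Xmin] := minX.
have [e ee] := ellis_idempotent cX hX X0 op_assoc op_continuous.
have ope x : op x e = x.
  suff : [set x | op x e = x] = setT by move=> /seteqP[_]; exact.
  apply: Xmin.
  - move=> {}x clx; apply: hX => A B nA nB.
    have nA' : nbhs x (op^~ e @^-1` A) by exact: op_continuous.
    have [x' [/= ex' [Ax' Bx']]] := clx _ (filterI nA' nB).
    by exists x'; split => //; rewrite -ex'.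
  - by move=> g _ [y ye <-]; rewrite /= op_act ye.
  - by exists e.
exists e; split.
- move=> A [oA cA].
  have sub B x : open B -> B x -> Phi [set g | B (act g e)] x.
    by move=> oB Bx; apply: opP; rewrite ope; exact: open_nbhs_nbhs.
  apply/seteqP; split=> [x PA|x]; last exact: sub.
  apply: contrapT => nAx; have := sub (~` A) x (closed_openC cA) nAx.
  by rewrite -[X in Phi X]/(~` [set g | A (act g e)]) PhiC.
(* If no clopen set separates [x] from [y], every [Phi S] containing [x] contains [y]; then [op x e]
   is also the limit for [y], which forces [x = y]. *)
- move=> x y xy; apply: contrapT => nsep; move/eqP: xy; apply.
  rewrite -[x]ope -[y]ope; apply: (ulim_unique (x := y) (y := e)) => // A nA.
  apply: contrapT => nP; apply: nsep; exists (Phi [set g | A (act g e)]).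
  by split => //; apply: opP.
Qed.

End Retraction.

(** * Injections of bounded displacement *)

Section BoundedDisplacement.
Variables (G : eqType) (mul : G -> G -> G) (one : G) (inv : G -> G).
Hypothesis groupG : is_group mul one inv.

Lemma group_mulKg g h : mul (inv g) (mul g h) = h.
Proof. by have [mA m1 mV] := groupG; rewrite mA mV m1. Qed.

Lemma group_mulI g : injective (mul g).
Proof. by move=> h k e; rewrite -(group_mulKg g h) e group_mulKg. Qed.

Lemma group_mulVK g h : mul g (mul (inv g) h) = h.
Proof. by apply: (@group_mulI (inv g)); rewrite group_mulKg. Qed.

Lemma group_mulgV g : mul g (inv g) = one.
Proof.
have [mA m1 mV] := groupG.
have mg1 h : mul h one = h by rewrite -(mV h) group_mulVK.
by rewrite -[inv g]mg1 group_mulVK.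
Qed.

Lemma group_mulIr g : injective (mul^~ g).
Proof.
have [mA m1 mV] := groupG.
have mg1 h : mul h one = h by rewrite -(mV h) group_mulVK.
by move=> h k /= e; rewrite -[h]mg1 -(group_mulgV g) mA e -mA group_mulgV mg1.
Qed.

(** The projections [p1] and [p2] to the group let one notion serve for [G], for [G * nat] and for
    numbered copies of [G * nat]. *)
Definition displaced (T1 T2 : Type) (p1 : T1 -> G) (p2 : T2 -> G) (F : seq G)
    (a : set T1) (f : T1 -> T2) :=
  forall x, a x -> exists2 g, g \in F & p2 (f x) = mul g (p1 x).

Definition bd_inj (T1 T2 : Type) (p1 : T1 -> G) (p2 : T2 -> G)
    (a : set T1) (b : set T2) :=
  exists F f, [/\ set_fun a b f, set_inj a f & displaced p1 p2 F a f].

Definition bd_bij (T1 T2 : Type) (p1 : T1 -> G) (p2 : T2 -> G)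
    (a : set T1) (b : set T2) :=
  exists F f, set_bij a b f /\ displaced p1 p2 F a f.

Section TwoTypes.
Variables (T1 T2 : Type) (p1 : T1 -> G) (p2 : T2 -> G).

Lemma bd_bij_inj a b : bd_bij p1 p2 a b -> bd_inj p1 p2 a b.
Proof. by move=> [F [f [[fab fI _] fd]]]; exists F, f. Qed.

Lemma bd_bij_sym (t : T1) a b : bd_bij p1 p2 a b -> bd_bij p2 p1 b a.
Proof.
move=> [F [f [[fab fI fS] fd]]].
(* Outside [b] the inverse takes the arbitrary value [t]. *)
have /choice[f' f'P] y : exists x, b y -> a x /\ f x = y.
  have [by_|nby] := pselect (b y); last by exists t.
  by have [x ax <-] := fS _ by_; exists x.
exists (map inv F), f'; split; first split.
- by move=> y /f'P[].
- move=> y z /set_mem/f'P[_ {2}<-] /set_mem/f'P[_ {2}<-] ->//.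
- move=> x ax; exists (f x); first exact: fab.
  have [ax' fx'] := f'P _ (fab _ ax).
  by apply: fI => //; exact/mem_set.
- move=> y /f'P[ax fx]; have [g gF e] := fd _ ax.
  exists (inv g); first exact: map_f.
  by rewrite -{2}fx e group_mulKg.
Qed.

Lemma bd_bijU a1 a2 b1 b2 : a1 `&` a2 = set0 -> b1 `&` b2 = set0 ->
  bd_bij p1 p2 a1 b1 -> bd_bij p1 p2 a2 b2 ->
  bd_bij p1 p2 (a1 `|` a2) (b1 `|` b2).
Proof.
move=> a0 b0 [F1 [f1 [[f1f f1I f1S] f1d]]] [F2 [f2 [[f2f f2I f2S] f2d]]].
pose f x := if pselect (a1 x) then f1 x else f2 x.
have fE1 x : a1 x -> f x = f1 x by rewrite /f; case: pselect.
have fE2 x : a2 x -> f x = f2 x.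
  rewrite /f; case: pselect => // a1x a2x.
  by have : (a1 `&` a2) x by []; rewrite a0.
have nb y : b1 y -> b2 y -> False.
  by move=> b1y b2y; have : (b1 `&` b2) y by []; rewrite b0.
exists (F1 ++ F2), f; split; first split.
- move=> x [ax|ax]; [rewrite fE1|rewrite fE2] => //; [left|right].
    exact: f1f.
  exact: f2f.
- move=> x y /set_mem[ax|ax] /set_mem[ay|ay].
  + by rewrite !fE1//; apply: f1I; exact/mem_set.
  + by rewrite fE1// fE2// => e; case: (nb _ (f1f _ ax)); rewrite e; exact: f2f.
  + by rewrite fE2// fE1// => e; case: (nb _ (f1f _ ay)); rewrite -e; exact: f2f.
  + by rewrite !fE2//; apply: f2I; exact/mem_set.
- move=> y [/f1S|/f2S] [x ax <-]; exists x; [by left|exact: fE1|by right|exact: fE2].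
- move=> x [ax|ax]; [rewrite fE1//|rewrite fE2//].
    by have [g gF e] := f1d _ ax; exists g => //; rewrite mem_cat gF.
  by have [g gF e] := f2d _ ax; exists g => //; rewrite mem_cat gF orbT.
Qed.

End TwoTypes.

Section ThreeTypes.
Variables (T1 T2 T3 : Type) (p1 : T1 -> G) (p2 : T2 -> G) (p3 : T3 -> G).

Lemma displaced_comp F F' a b f f' : set_fun a b f -> displaced p1 p2 F a f ->
  displaced p2 p3 F' b f' ->
  displaced p1 p3 [seq mul g' g | g' <- F', g <- F] a (f' \o f).
Proof.
have [mA _ _] := groupG.
move=> fab fd fd' x ax; have [g gF e] := fd _ ax.
have [g' gF' e'] := fd' _ (fab _ ax).
exists (mul g' g); first by apply/allpairsP; exists (g', g).
by rewrite /= e' e mA.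
Qed.

Lemma bd_inj_trans a b c :
  bd_inj p1 p2 a b -> bd_inj p2 p3 b c -> bd_inj p1 p3 a c.
Proof.
move=> [F [f [fab fI fd]]] [F' [f' [fbc fI' fd']]].
exists [seq mul g' g | g' <- F', g <- F], (f' \o f); split.
- by move=> x ax; apply: fbc; exact: fab.
- move=> x y /set_mem ax /set_mem ay e; apply: fI; try exact/mem_set.
  by apply: fI' => //; apply/mem_set; exact: fab.
- exact: displaced_comp fab fd fd'.
Qed.

Lemma bd_bij_trans a b c :
  bd_bij p1 p2 a b -> bd_bij p2 p3 b c -> bd_bij p1 p3 a c.
Proof.
move=> [F [f [fb fd]]] [F' [f' [fb' fd']]].
exists [seq mul g' g | g' <- F', g <- F], (f' \o f); split.
  exact: set_bij_comp fb fb'.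
by apply: displaced_comp fd fd'; have [] := fb.
Qed.

End ThreeTypes.

Lemma bd_bij_refl (T : Type) (p : T -> G) a : bd_bij p p a a.
Proof.
have [_ m1 _] := groupG.
exists [:: one], id; split; first by split => // y ay; exists y.
by move=> x _; exists one; rewrite ?inE//= m1.
Qed.

Lemma subset_bd_inj (T : Type) (p : T -> G) a b : a `<=` b -> bd_inj p p a b.
Proof.
have [_ m1 _] := groupG.
move=> ab; exists [:: one], id; split => //.
by move=> x _; exists one; rewrite ?inE//= m1.
Qed.

Lemma bd_schroeder_bernstein (T1 T2 : Type) (p1 : T1 -> G) (p2 : T2 -> G) a b :
  bd_inj p1 p2 a b -> bd_inj p2 p1 b a -> bd_bij p1 p2 a b.
Proof.
move=> [F [f [fab fI fd]]] [F' [f' [fba fI' fd']]].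
(* [D]: the points with a finite backward orbit ending outside the image of [f']. *)
pose D x := exists n z, [/\ a z, ~ (f' @` b) z & iter n (f' \o f) z = x].
have Da x : D x -> a x.
  move=> [n [z [az _ <-]]]; elim: n => //= n IH.
  by apply: fba; exact: fab.
have DS x : D x -> D (f' (f x)).
  by move=> [n [z [az nz <-]]]; exists n.+1, z.
have /choice[h hP] x : exists y, a x ->
    b y /\ ((D x /\ y = f x) \/ (~ D x /\ f' y = x)).
  have [ax|nax] := pselect (a x); last by exists (f x).
  have [Dx|nDx] := pselect (D x).
    by exists (f x) => _; split; [exact: fab|left].
  have [[y by_ yx]|ny] := pselect ((f' @` b) x).
    by exists y => _; split => //; right.
  by case: nDx; exists 0%N, x.
have fI2 x y : a x -> a y -> f x = f y -> x = y.
  by move=> ax ay; apply: fI; exact/mem_set.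
have fI2' x y : b x -> b y -> f' x = f' y -> x = y.
  by move=> bx by_; apply: fI'; exact/mem_set.
(* On [D] the map [h] is [f], off [D] it inverts [f']; hence its displacements come from [F] and
   from the inverses of [F']. *)
exists (F ++ map inv F'), h; split; first split.
- by move=> x /hP[].
- move=> x y /set_mem ax /set_mem ay e.
  have [bhx [[Dx hx]|[nDx hx]]] := hP _ ax;
    have [bhy [[Dy hy]|[nDy hy]]] := hP _ ay.
  + by apply: fI2 => //; rewrite -hx e.
  + by case: nDy; rewrite -hy -e hx; exact: DS.
  + by case: nDx; rewrite -hx e hy; exact: DS.
  + by rewrite -hx e.
- move=> y by_; have afy := fba _ by_.
  have [bh [[Dx hx]|[nDx hx]]] := hP _ afy; last first.
    by exists (f' y) => //; exact: fI2'.
  (* The backward orbit of [f' y] cannot have length zero, as it starts outside the image of [f'];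
     its previous point is sent to [y] by [f]. *)
  have [[|n] [z [az nz e]]] := Dx; first by case: nz; exists y.
  have Dn : D (iter n (f' \o f) z) by exists n, z.
  exists (iter n (f' \o f) z); first exact: Da.
  have [_ [[_ ->]|[//]]] := hP _ (Da _ Dn).
  by apply: fI2' => //; apply: fab; exact: Da.
- move=> x ax; have [bh [[Dx ->]|[nDx hx]]] := hP _ ax.
    by have [g gF e] := fd _ ax; exists g => //; rewrite mem_cat gF.
  have [g gF e] := fd' _ bh; exists (inv g).
    by rewrite mem_cat map_f ?orbT.
  by rewrite -{2}hx e group_mulKg.
Qed.

End BoundedDisplacement.

(** * Transfer between clopen sets and subsets of the group *)

Section Transfer.
Variables (G : countType) (mul : G -> G -> G) (one : G) (inv : G -> G).
Variables (X : topologicalType) (act : G -> X -> X) (Phi : set G -> set X).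
Variable x0 : X.
Hypothesis groupG : is_group mul one inv.
Hypothesis actionX : is_action mul one act.
Hypothesis Phi_clopen : forall S, clopen (Phi S).
Hypothesis PhiT : Phi setT = setT.
Hypothesis PhiI : forall S S', Phi (S `&` S') = Phi S `&` Phi S'.
Hypothesis PhiC : forall S, Phi (~` S) = ~` Phi S.
Hypothesis Phi_act : forall g S, Phi [set h | S (mul g h)] = act g @^-1` Phi S.
Hypothesis Phi_orbit : forall A, clopen A -> Phi [set g | A (act g x0)] = A.

Let Phi0 : Phi set0 = set0. Proof. exact: set_hom0. Qed.

(** The group elements that bring [x0] into each slice of [A]. Conversely [clopen_lift] applies
    [Phi] slice by slice, and it undoes the trace on clopen sets. *)
Definition orbit_trace (A : set (X * nat)) : set (G * nat) :=
  [set p | A (act p.1 x0, p.2)].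

Definition clopen_lift (a : set (G * nat)) : set (X * nat) :=
  [set q | Phi [set g | a (g, q.2)] q.1].

Local Notation tr := orbit_trace.
Local Notation lift := clopen_lift.
Local Notation eqd := (bd_bij mul (@fst G nat) (@fst G nat)).
Local Notation led := (bd_inj mul (@fst G nat) (@fst G nat)).

Lemma orbit_traceK A : clopenY A -> lift (tr A) = A.
Proof.
move=> clA; apply/seteqP; split=> -[x k];
by rewrite /clopen_lift /orbit_trace /= (Phi_orbit (clA k)).
Qed.

Lemma orbit_trace_bounded A : boundedY A -> boundedY (tr A).
Proof. by move=> [N AN]; exists N => g k /AN. Qed.

Lemma clopen_lift_bclopen a : boundedY a -> bclopen (lift a).
Proof.
move=> [N aN]; split; first by move=> k; exact: (Phi_clopen [set g | a (g, k)]).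
exists N => x k; rewrite /clopen_lift /=.
have [//|Nk] := ltnP k N.
have -> : [set g | a (g, k)] = set0; last by rewrite Phi0.
by apply/seteqP; split=> // g /aN; rewrite ltnNge Nk.
Qed.

Lemma clopen_liftI a b : lift (a `&` b) = lift a `&` lift b.
Proof.
have E k : [set g | (a `&` b) (g, k)] = [set g | a (g, k)] `&` [set g | b (g, k)].
  by [].
by apply/seteqP; split=> -[x k]; rewrite /clopen_lift /= E PhiI.
Qed.

Lemma clopen_lift0 : lift set0 = set0.
Proof. by apply/seteqP; split=> -[x k]; rewrite /clopen_lift /= Phi0. Qed.

Lemma clopen_lift_subset a b : a `<=` b -> lift a `<=` lift b.
Proof. by move=> /setIidPl <-; rewrite clopen_liftI => q []. Qed.

Lemma clopen_lift_bigcup n (P : 'I_n -> set (G * nat)) :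
  lift (\bigcup_i P i) = \bigcup_i lift (P i).
Proof.
have E k : [set g | (\bigcup_i P i) (g, k)] = \bigcup_i [set g | P i (g, k)] by [].
apply/seteqP; split=> -[x k]; rewrite /clopen_lift /= E set_hom_bigcup_ord//.
Qed.

Lemma clopen_lift_tact g s a : bijective s ->
  tact act g s @` lift a = lift (tact mul g s @` a).
Proof.
have [_ act1 actM] := actionX; have [_ m1 mV] := groupG.
move=> [s' sK s'K]; apply/seteqP; split=> [_ [[x k] xk <-]|[y l]].
  rewrite /clopen_lift/=.
  rewrite -[Phi _ _]/((act g @^-1` Phi [set h | (tact mul g s @` a) (h, s k)]) x).
  rewrite -Phi_act; apply: (set_hom_subset PhiI) xk => h /= ahk.
  by exists (h, k).
rewrite /clopen_lift/= => yl; exists (act (inv g) y, s' l); last first.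
  by rewrite /tact/= s'K -actM (group_mulgV groupG) act1.
rewrite /= -[Phi _ _]/((act (inv g) @^-1` Phi [set h | a (h, s' l)]) y).
rewrite -Phi_act; apply: (set_hom_subset PhiI) yl => h /= [[h' k] ahk [<- <-]].
by rewrite (group_mulKg groupG) sK.
Qed.

Lemma tact_inj g s : injective s -> injective (tact mul g s).
Proof.
by move=> sI [h k] [h' k'] [/(group_mulI groupG) -> /sI ->].
Qed.

(** The same pieces and group elements work on the trace, since left multiplication by [g i] covers
    the action of [g i] along the orbit. *)
Lemma equidec_trace A B : equidec act A B -> eqd (tr A) (tr B).
Proof.
have [_ _ actM] := actionX.
move=> [_ _ [n [P [g [s [sB [_ [Pd Qd -> ->]]]]]]]].
have /choice[f fP] (p : G * nat) : exists q, tr (\bigcup_i P i) p ->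
    exists2 i, P i (act p.1 x0, p.2) & q = tact mul (g i) (s i) p.
  have [[i _ Pi]|nP] := pselect (tr (\bigcup_i P i) p); last by exists p.
  by exists (tact mul (g i) (s i) p) => _; exists i.
have tactE i p : tact act (g i) (s i) (act p.1 x0, p.2) =
    (act (tact mul (g i) (s i) p).1 x0, (tact mul (g i) (s i) p).2).
  by rewrite /tact /= actM.
exists (codom g), f; split; first split.
- move=> p /fP[i Pi ->]; exists i => //; exists (act p.1 x0, p.2) => //.
- move=> p q /set_mem/fP[i Pi ->] /set_mem/fP[j Pj ->].
  have [<-|ij] := eqVneq i j; first by apply: tact_inj; exact/bij_inj/sB.
  move=> e; have := Qd _ _ ij; move=> /seteqP[+ _].
  move=> /(_ (act (tact mul (g i) (s i) p).1 x0, (tact mul (g i) (s i) p).2)).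
  case; split; first by exists (act p.1 x0, p.2).
  by exists (act q.1 x0, q.2) => //; rewrite e.
- move=> [h l] [i _ [[x k] Pi]] => -[eh el].
  (* A point that [g i] moves to the orbit point [act h x0] lies on the orbit itself. *)
  have xE : x = act (mul (inv (g i)) h) x0.
    have [_ act1 _] := actionX; have [_ _ mV] := groupG.
    by rewrite actM -eh -actM mV act1.
  have Pp : P i (act (mul (inv (g i)) h) x0, k) by rewrite -xE.
  have trp : tr (\bigcup_i P i) (mul (inv (g i)) h, k) by exists i.
  exists (mul (inv (g i)) h, k) => //.
  have [j Pj ->] := fP _ trp; rewrite /= in Pj.
  have [<-|ij] := eqVneq i j.
    by rewrite /tact /= (group_mulVK groupG) el.
  by have /seteqP[+ _] := Pd _ _ ij => /(_ (act (mul (inv (g i)) h) x0, k)) [].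
- move=> p /fP[i Pi ->]; exists (g i) => //; exact: codom_f.
Qed.

(** Cut [a] by displacement, source level and target level: finitely many pieces, as [F] is finite
    and the levels are bounded. On each piece the bijection is a translation with a permutation of
    levels, and [Phi] preserves the partition. *)
Lemma equidec_lift a b : boundedY a -> boundedY b -> eqd a b ->
  equidec act (lift a) (lift b).
Proof.
move=> ba bb [F [f [[fab fI fS] fd]]].
have [N aN] := ba; have [M bM] := bb.
pose L := undup [seq (g, kl) | g <- F, kl <- allpairs pair (iota 0 N) (iota 0 M)].
pose t (i : 'I_(size L)) := tnth (in_tuple L) i.
pose P i := a `&` [set p | p.2 = (t i).2.1 /\ f p = (mul (t i).1 p.1, (t i).2.2)].
have tI : injective t by apply/tuple_uniqP; exact: undup_uniq.
(* Swapping the two levels extends the change of level to a permutation of [nat]. *)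
pose s i : nat -> nat := fun k =>
  if k == (t i).2.1 then (t i).2.2 else if k == (t i).2.2 then (t i).2.1 else k.
have sK i : involutive (s i).
  move=> k; rewrite /s; have [->|k1] := eqVneq k (t i).2.1.
    by rewrite eqxx; case: eqVneq.
  have [->|k2] := eqVneq k (t i).2.2; first by rewrite eqxx.
  by rewrite (negPf k1) (negPf k2).
have sB i : bijective (s i) by exists (s i); exact: sK.
have fE i p : P i p -> tact mul (t i).1 (s i) p = f p.
  by case: p => g k [_ /= [kE ->]]; rewrite /tact /= /s kE eqxx.
have fPE i : tact mul (t i).1 (s i) @` P i = f @` P i.
  by apply/seteqP; split=> _ [p Pp <-]; exists p; rewrite ?fE.
(* Right cancellation recovers the displacement from [p] and [f p], so a point has only one
   index. *)
have Pdisj i j p : P i p -> P j p -> i = j.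
  move=> [_ [k1 e1]] [_ [k2 e2]]; apply: tI.
  move: e1; rewrite e2 => -[/(group_mulIr groupG) eg el].
  move: eg el k2; rewrite k1.
  by case: (t i) => ? [? ?]; case: (t j) => ? [? ?] /= -> -> ->.
have aE : a = \bigcup_i P i.
  apply/seteqP; split=> [[g k] agk|p [i _ []//]].
  have [h hF hE] := fd _ agk.
  case fgk : (f (g, k)) => [g' l]; rewrite fgk /= in hE.
  have hL : (h, (k, l)) \in L.
    rewrite mem_undup; apply/allpairsP; exists (h, (k, l)); split => //=.
    apply/allpairsP; exists (k, l); split => //=.
      by rewrite mem_iota /=; exact: aN agk.
    by rewrite mem_iota /=; apply: (bM g'); rewrite -fgk; exact: fab.
  have iL : (index (h, (k, l)) L < size L)%N by rewrite index_mem.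
  have tE : t (Ordinal iL) = (h, (k, l)).
    by rewrite /t (tnth_nth (h, (k, l))) /= nth_index.
  by exists (Ordinal iL) => //; split => //=; rewrite tE /= fgk hE.
have bE : b = \bigcup_i (tact mul (t i).1 (s i) @` P i).
  apply/seteqP; split=> [q /fS[p ap <-]|q [i _]].
    move: (ap); rewrite {1}aE => -[i _ Pp]; exists i => //.
    by rewrite fPE; exists p.
  by rewrite fPE => -[p [ap _] <-]; exact: fab.
split; [exact: clopen_lift_bclopen|exact: clopen_lift_bclopen|].
exists (size L), (lift \o P), (fst \o t), s; split => //; split.
  by move=> i; apply: (clopen_lift_bclopen _).1; exists N => g k [/aN].
split.
- move=> i j ij; rewrite /= -clopen_liftI.
  have -> : P i `&` P j = set0; last exact: clopen_lift0.
  by apply/seteqP; split=> // p [Pi Pj]; move: ij; rewrite (Pdisj _ _ _ Pi Pj) eqxx.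
- move=> i j ij; rewrite /= !clopen_lift_tact// -clopen_liftI.
  suff -> : tact mul (t i).1 (s i) @` P i `&` tact mul (t j).1 (s j) @` P j = set0.
    exact: clopen_lift0.
  rewrite !fPE; apply/seteqP; split=> // _ [[p Pp <-] [q Pq e]].
  have pq : q = p by apply: fI => //; apply/mem_set; [case: Pq|case: Pp].
  by move: ij; rewrite (Pdisj _ _ _ Pp (_ : P j p)) ?eqxx// -pq.
- by rewrite {1}aE clopen_lift_bigcup.
- rewrite {1}bE clopen_lift_bigcup; apply: eq_bigcupr => i _.
  by rewrite /= clopen_lift_tact.
Qed.

Lemma equidec_traceP A B : bclopen A -> bclopen B ->
  eqd (tr A) (tr B) -> equidec act A B.
Proof.
move=> [clA bA] [clB bB] AB; rewrite -(orbit_traceK clA) -(orbit_traceK clB).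
by apply: equidec_lift => //; exact: orbit_trace_bounded.
Qed.

Lemma equidec_refl A : bclopen A -> equidec act A A.
Proof. by move=> bA; apply: equidec_traceP => //; exact: bd_bij_refl groupG _ _ _. Qed.

Lemma tsum_trace A B C : tsum act A B C -> exists a b,
  [/\ eqd (tr A) a, eqd (tr B) b, a `&` b = set0 & eqd (a `|` b) (tr C)].
Proof.
move=> [A' [B' [/equidec_trace AA /equidec_trace BB AB0 /equidec_trace ABC]]].
exists (tr A'), (tr B'); split => //.
by apply/seteqP; split=> // p AB; have : (A' `&` B') (act p.1 x0, p.2) by []; rewrite AB0.
Qed.

Lemma tle_trace A B : tle act A B -> led (tr A) (tr B).
Proof.
move=> [_ _ [C [_ /tsum_trace[a [c [Aa _ _ acB]]]]]].
apply: (bd_inj_trans groupG (bd_bij_inj Aa)).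
apply: (bd_inj_trans groupG _ (bd_bij_inj acB)).
exact: (subset_bd_inj groupG).
Qed.

(** The image of the trace of [A] lifts to a clopen subset of [B] equidecomposable with [A]; the
    rest of [B] is the missing summand. *)
Lemma tle_traceP A B : bclopen A -> bclopen B ->
  led (tr A) (tr B) -> tle act A B.
Proof.
move=> bA bB [F [f [fAB fI fd]]].
pose c := f @` tr A.
have cB : c `<=` tr B by move=> _ [p Ap <-]; exact: fAB.
have bc : boundedY c.
  have [N BN] := orbit_trace_bounded bB.2.
  by exists N => g k /cB /BN.
have AC : equidec act A (lift c).
  rewrite -{1}(orbit_traceK bA.1); apply: equidec_lift => //.
    exact/orbit_trace_bounded/bA.2.
  by exists F, f; split => //; split => // p Ap; exists p.
have CB : lift c `<=` B by rewrite -(orbit_traceK bB.1); exact: clopen_lift_subset.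
have bC : bclopen (lift c) := clopen_lift_bclopen bc.
have bD : bclopen (B `\` lift c).
  split; last by have [N BN] := bB.2; exists N => x k [/BN].
  move=> k; rewrite -[X in clopen X]/([set x | B (x, k)] `\` [set x | lift c (x, k)]).
  exact: (clopenD (bB.1 k) (bC.1 k)).
split => //; exists (B `\` lift c); split => //.
exists (lift c), (B `\` lift c); split => //.
- exact: equidec_refl.
- by rewrite setDIK.
- by rewrite setDUK//; exact: equidec_refl.
Qed.

(** The first coordinate numbers [n] disjoint copies of the trace of [A], so multiples in the
    semigroup become disjoint unions of copies. *)
Lemma tnsum_trace n A C : tnsum act n A C ->
  bd_bij mul (fst \o snd) (@fst G nat) [set q : nat * (G * nat) | (q.1 < n)%N /\ tr A q.2] (tr C).
Proof.
elim: n C => [|n IH] C.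
  move=> /equidec_trace e; apply: (bd_bij_trans groupG _ e).
  exists [::], snd; split; last by move=> q [].
  by split => [q []|q q' /set_mem[]|].
move=> [D [/IH nAD /tsum_trace[d [a [Dd Aa da0 daC]]]]].
apply: (bd_bij_trans groupG _ daC).
pose m : set (nat * (G * nat)) := [set q | q.1 = n /\ tr A q.2].
have -> : [set q : nat * (G * nat) | (q.1 < n.+1)%N /\ tr A q.2] =
    [set q : nat * (G * nat) | (q.1 < n)%N /\ tr A q.2] `|` m.
  apply/seteqP; split=> [q [/= qn Aq]|q [[/= qn Aq]|[/= qn Aq]]].
  - by move: qn; rewrite ltnS leq_eqVlt => /orP[/eqP|]; [right|left].
  - by split => //=; exact: leqW.
  - by split => //=; rewrite qn.
apply: bd_bijU => //.
- by apply/seteqP; split=> // q [[/= qn _] [e _]]; rewrite e ltnn in qn.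
- exact: (bd_bij_trans groupG nAD Dd).
- apply: (bd_bij_trans groupG _ Aa).
  have [_ m1 _] := groupG.
  exists [:: one], snd; split; last first.
    by move=> q _; exists one; rewrite ?inE//= m1.
  split => [q []//|[i p] [j p']|p Ap]; last by exists (n, p).
  by move=> /set_mem[/= -> _] /set_mem[/= -> _] ->.
Qed.

Lemma tle_is_partial_order : tle_partial_order act.
Proof.
split.
- move=> A bA; apply: tle_traceP => //; exact: (subset_bd_inj groupG).
- move=> A B C AB BC; apply: tle_traceP; [by case: AB|by case: BC|].
  exact: (bd_inj_trans groupG (tle_trace AB) (tle_trace BC)).
- move=> A B AB BA; apply: equidec_traceP; [by case: AB|by case: AB|].
  apply: (bd_schroeder_bernstein groupG); exact: tle_trace.
Qed.

End Transfer.

(** * Hall's theorem for infinite families of finite sets *)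

Section Hall.
Local Open Scope fset_scope.
Variables (I J : choiceType) (D : set I).

Definition neighbours (A : I -> {fset J}) (S : {fset I}) : {fset J} :=
  \bigcup_(i <- S) A i.

Definition hall_condition (A : I -> {fset J}) :=
  forall S : {fset I}, (forall i, i \in S -> D i) ->
    (#|` S| <= #|` neighbours A S|)%N.

Lemma neighboursP A (S : {fset I}) y :
  reflect (exists2 i, i \in S & y \in A i) (y \in neighbours A S).
Proof.
apply: (iffP (bigfcupP _ _ _ _)) => [[i /andP[iS _] yA]|[i iS yA]]; exists i => //.
by rewrite iS.
Qed.

(* If both removals broke Hall's condition, at [S] and [S'], then submodularity of
   cardinality would break it at the union or at the intersection of [S] and [S']. *)
Lemma hall_condition_remove A y z i : hall_condition A -> D i -> y != z ->
  y \in A i -> z \in A i ->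
  hall_condition (fun j => if j == i then A j `\ y else A j) \/
  hall_condition (fun j => if j == i then A j `\ z else A j).
Proof.
move=> hA Di yz yA zA; apply: contrapT => /not_orP[].
pose B t j := if j == i then A j `\ t else A j.
have noB t : ~ hall_condition (B t) -> exists S : {fset I},
    [/\ forall j, j \in S -> D j, i \in S & (#|` neighbours (B t) S| < #|` S|)%N].
  move=> /existsNP[S /not_implyP[SD /negP]]; rewrite -ltnNge => lt.
  exists S; split => //; apply/negPn/negP => iS.
  have : (#|` S| <= #|` neighbours (B t) S|)%N; last by rewrite leqNgt lt.
  suff -> : neighbours (B t) S = neighbours A S by exact: hA.
  apply: eq_big_seq => j jS; rewrite /B; case: eqP => // ji.
  by rewrite -ji jS in iS.
move=> /noB[S [SD iS ltS]] /noB[S' [SD' iS' ltS']].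
pose P := neighbours (B y) S; pose Q := neighbours (B z) S'.
have cU : (#|` S `|` S'| <= #|` P `|` Q|)%N.
  apply: leq_trans (hA (S `|` S') _) _.
    by move=> j; rewrite inE => /orP[/SD|/SD'].
  apply: fsubset_leq_card; apply/fsubsetP => t /neighboursP[j jSS tA].
  have [ji|ji] := eqVneq j i.
    subst j; rewrite inE; have [ty|ty] := eqVneq t y.
      apply/orP; right; apply/neighboursP; exists i => //.
      by rewrite /B eqxx !inE tA ty yz.
    apply/orP; left; apply/neighboursP; exists i => //.
    by rewrite /B eqxx !inE tA ty.
  move: jSS; rewrite !inE => /orP[] jS; apply/orP; [left|right];
    by apply/neighboursP; exists j => //; rewrite /B (negPf ji).
have cI : (#|` (S `&` S') `\ i| <= #|` P `&` Q|)%N.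
  apply: leq_trans (hA _ _) _.
    by move=> j; rewrite !inE => /andP[_ /andP[/SD]].
  apply: fsubset_leq_card; apply/fsubsetP => t /neighboursP[j].
  rewrite !inE => /andP[ji /andP[jS jS']] tA.
  by apply/andP; split; apply/neighboursP; exists j => //; rewrite /B (negPf ji).
(* Removing [i] from the intersection costs one, while the two strict inequalities for [S] and [S']
   gain two. *)
have c1 : #|` S `&` S'| = (#|` (S `&` S') `\ i|).+1.
  by rewrite (cardfsD1 i) !inE iS iS' add1n.
have := cardfsUI S S'; have := cardfsUI P Q.
rewrite -/P -/Q in ltS ltS'; lia.
Qed.

(* Rado's proof: in a minimal family satisfying Hall's condition every member is a
   singleton; [U] collects the pairs that have been removed. *)
Lemma hall_rado (y0 : J) (A : I -> {fset J}) : hall_condition A ->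
  exists f : I -> J, (forall i, D i -> f i \in A i) /\
    (forall i j, D i -> D j -> f i = f j -> i = j).
Proof.
move=> hA.
pose rem (U : set (I * J)) i := [fset y in A i | `[< ~ U (i, y) >]].
have remP U i y : (y \in rem U i) = (y \in A i) && `[< ~ U (i, y) >].
  by rewrite !inE.
have [|U [hU Umax]] := @Zorn_bigcup (I * J)%type (fun U => hall_condition (rem U)).
  move=> F FP Ftot; have [->|/set0P F0] := eqVneq F set0.
    rewrite bigcup_set0; suff -> : rem set0 = A by [].
    apply/funext => i; apply/fsetP => y; rewrite remP.
    by rewrite (_ : `[< _ >] = true) ?andbT//; apply/asboolP.
  (* Hall's condition at a finite set involves finitely many pairs, and one member of the chain
     already contains those of them that lie in the union. *)
  have fin (s : seq (I * J)) : exists2 U, F U &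
      forall p, p \in s -> (\bigcup_(X in F) X)%classic p -> U p.
    elim: s => [|p s [U FU Us]]; first by case: F0 => U FU; exists U.
    have [[V FV Vp]|nVp] := pselect ((\bigcup_(X in F) X)%classic p); last first.
      by exists U => // q; rewrite inE => /orP[/eqP ->//|]; exact: Us.
    have [UV|VU] := Ftot _ _ FU FV.
      exists V => // q; rewrite inE => /orP[/eqP ->//|qs Fq].
      by apply: UV; exact: Us.
    exists U => // q; rewrite inE => /orP[/eqP -> _|]; [exact: VU|exact: Us].
  move=> S SD.
  have [U FU Us] := fin [seq (i, y) | i <- S, y <- A i].
  suff -> : neighbours (rem (\bigcup_(X in F) X)%classic) S = neighbours (rem U) S.
    exact: FP.
  apply: eq_big_seq => i iS; apply/fsetP => y; rewrite !remP.
  have [yA/=|//] := boolP (y \in A i).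
  apply: asbool_equiv_eq; split=> [nF Uy|nU Fy].
    by apply: nF; exists U.
  by apply: nU; apply: Us => //; apply/allpairsPdep; exists i, y.
(* Of two distinct members one could still be removed, against maximality of [U]. *)
have one_elt i y z : D i -> y \in rem U i -> z \in rem U i -> y = z.
  move=> Di yU zU; apply/eqP; apply/negPn/negP => yz.
  have maxU t : t \in rem U i ->
      ~ hall_condition (fun j => if j == i then rem U j `\ t else rem U j).
    rewrite remP => /andP[_ /asboolP nUt] hUt.
    apply: (Umax (U `|` [set (i, t)])%classic).
      split; first by move=> p; left.
      by move=> /(_ (i, t)) h; apply: nUt; apply: h; right.
    suff -> : rem (U `|` [set (i, t)])%classic =
        (fun j => if j == i then rem U j `\ t else rem U j) by [].
    apply/funext => j; apply/fsetP => u; rewrite remP.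
    have -> : `[< ~ (U `|` [set (i, t)])%classic (j, u) >] =
        `[< ~ U (j, u) >] && ~~ ((j == i) && (u == t)).
      apply/asboolP/andP => [nU|[/asboolP nU /negP ne] [//|[e1 e2]]].
        split; first by apply/asboolP => Uj; apply: nU; left.
        by apply/negP => /andP[/eqP ji /eqP ut]; apply: nU; right; rewrite ji ut.
      by apply: ne; rewrite e1 e2 !eqxx.
    have [ji|ji] := eqVneq j i; last by rewrite /= remP andbT.
    by rewrite /= in_fsetD1 remP andbA [RHS]andbC.
  by have [] := hall_condition_remove hU Di yz yU zU; exact: maxU.
have ex i : exists y, D i -> y \in rem U i.
  have [Di|nDi] := pselect (D i); last by exists y0.
  have := hU [fset i]; rewrite cardfs1 cardfs_gt0 => /(_ _)/fset0Pn.
  case=> [j|y /neighboursP[j]]; first by rewrite inE => /eqP ->.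
  by rewrite inE => /eqP -> yU; exists y.
have [f fP] := choice ex.
exists f; split.
  by move=> i /fP; rewrite remP => /andP[].
move=> i j Di Dj fij; apply/eqP/negPn/negP => ij.
have : (#|` [fset i; j]| <= #|` neighbours (rem U) [fset i; j]|)%N.
  by apply: hU => k; rewrite !inE => /orP[] /eqP ->.
rewrite cardfs2 ij; apply/negP; rewrite -ltnNge ltnS.
apply: (@leq_trans #|` [fset f i]|); last by rewrite cardfs1.
apply: fsubset_leq_card; apply/fsubsetP => y /neighboursP[k + yU].
rewrite !inE => /orP[] /eqP kE; rewrite {}kE in yU; apply/eqP.
  by apply: (one_elt i) => //; exact: fP.
by rewrite fij; apply: (one_elt j) => //; exact: fP.
Qed.

End Hall.

Lemma cardfsM (K K' : choiceType) (A : {fset K}) (B : {fset K'}) :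
  #|` (A `*` B)%fset| = (#|` A| * #|` B|)%N.
Proof.
rewrite -(size_allpairs pair A B); apply/perm_size/uniq_perm.
- exact: fset_uniq.
- by apply: allpairs_uniq; rewrite ?fset_uniq// => -[? ?] [? ?].
- move=> [x y]; rewrite in_fsetM /=; apply/andP/allpairsP => [[xA yB]|].
    by exists (x, y).
  by move=> [[x' y'] /= [xA yB [-> ->]]].
Qed.

(** * Cancellation of multiples by Hall's theorem *)

Section Cancellation.
Variables (G : countType) (mul : G -> G -> G) (one : G).

(** The targets in [b] allowed for [p]; the bound [N] on levels keeps the set finite, as Hall's
    theorem requires. *)
Definition translates (F : seq G) (N : nat) (b : set (G * nat)) (p : G * nat) :
    {fset G * nat} :=
  [fset q in [seq (mul g p.1, l) | g <- F, l <- iota 0 N] | `[< b q >]]%fset.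

Lemma translatesP F N b p q : reflect
  (b q /\ exists2 g, g \in F & q.1 = mul g p.1 /\ (q.2 < N)%N)
  (q \in translates F N b p).
Proof.
rewrite !inE /=; apply: (iffP andP) => [[/allpairsP[[g l] /= [gF lN ->]] /asboolP bq]|].
  by split => //; exists g => //; split => //; rewrite mem_iota in lN.
move=> [bq [g gF [q1 q2]]]; split; last exact/asboolP.
by apply/allpairsP; exists (g, q.2); rewrite /= mem_iota -q1; split => //; case: (q).
Qed.

Lemma hall_bd_inj F N a b : hall_condition a (translates F N b) ->
  bd_inj mul fst fst a b.
Proof.
move=> /(hall_rado (one, 0%N))[f [fN fI]].
exists F, f; split.
- by move=> p /fN/translatesP[].
- by move=> p q /set_mem ap /set_mem aq; exact: fI.
- by move=> p /fN/translatesP[_ [g gF [e _]]]; exists g.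
Qed.

(** For finite [S] inside [a], the injection embeds [n] copies of [S] into [n] copies of its
    neighbours. Dividing the cardinalities by [n] gives Hall's condition. *)
Lemma bd_inj_cancel n (a b : set (G * nat)) : (0 < n)%N -> boundedY b ->
  bd_inj mul (fst \o snd) (fst \o snd)
    [set q : nat * (G * nat) | (q.1 < n)%N /\ a q.2]
    [set q : nat * (G * nat) | (q.1 < n)%N /\ b q.2] ->
  bd_inj mul fst fst a b.
Proof.
move=> n0 [N bN] [F [f [fab fI fd]]]; apply: (@hall_bd_inj F N) => S Sa.
pose I := [fset i in iota 0 n]%fset.
have cI : #|` I| = n.
  by rewrite card_fseq undup_id ?iota_uniq// size_iota.
have inI i : (i \in I) = (i < n)%N by rewrite !inE mem_iota.
rewrite -(leq_pmul2l n0) -{1 2}cI -!cardfsM.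
have -> : #|` (I `*` S)%fset| = #|` f @` (I `*` S)%fset|%fset.
  rewrite card_in_imfset // => q q' /=; rewrite !in_fsetM !inI => /andP[qn qS] /andP[qn' qS'].
  by apply: fI; apply/mem_set; split => //; exact: Sa.
apply: fsubset_leq_card; apply/fsubsetP => _ /imfsetP[q /= + ->].
rewrite !in_fsetM !inI => /andP[qn qS].
have aq : [set q : nat * (G * nat) | (q.1 < n)%N /\ a q.2] q.
  by split => //; exact: Sa.
have [fqn bfq] := fab _ aq; rewrite fqn /=.
have [g gF e] := fd _ aq.
apply/neighboursP; exists q.2 => //; apply/translatesP; split => //.
exists g => //; split => //; apply: (bN (f q).2.1); by case: (f q).2 bfq.
Qed.

End Cancellation.

(** * Foelner sets from the failure of the Hall condition *)

Section Folner.
Variables (G : countType) (mul : G -> G -> G) (one : G) (inv : G -> G).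
Hypothesis groupG : is_group mul one inv.
Local Open Scope fset_scope.

Definition fset_part (T : {fset G}) (S : set G) : {fset G} :=
  [fset x in T | `[< S x >]].

Definition fset_translate (g : G) (T : {fset G}) : {fset G} :=
  [fset mul g x | x in T].

Lemma fset_partP T S x : reflect (x \in T /\ S x) (x \in fset_part T S).
Proof. by rewrite !inE; apply: (iffP andP) => -[xT /asboolP]. Qed.

Lemma no_bd_inj_folner (a b : set G) (K E : seq G) (m : nat) : (0 < m)%N ->
  (forall g, exists2 k, k \in K & b (mul k g)) ->
  ~ bd_inj mul id id a b ->
  exists T : {fset G},
    [/\ T != fset0, (#|` fset_part T b| <= #|` fset_part T a|)%N &
        forall g, g \in E ->
          (m * #|` fset_translate g T `\` T| <= #|` T|)%N].
Proof.
have [mA m1 _] := groupG.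
move=> m0 Kb noinj.
(* The element [one] makes the sets [T k] increase, [K] brings every point into [b], and [E] holds
   the translations to be controlled. *)
pose E' := one :: K ++ E.
(* A Hall violator [S] for the displacement set [E'^n]: if no [T k = E'^k S], [k < n],
   were nearly [E]-invariant, [T (n-1)] would outgrow the bound [size K * #|S|] coming
   from syndeticity of [b]. *)
pose ball k := iter k (fun F => [seq mul g h | g <- E', h <- F]) [:: one].
have ballS k : ball k.+1 = [seq mul g h | g <- E', h <- ball k] by [].
(* After [m * size K] steps, each adding at least [#|S|] to [m * #|T k|], the syndeticity bound is
   exceeded; one further step leaves room to move into [b]. *)
pose n := (m * size K).+1.
pose N F (x : G) : {fset G} := [fset y in [seq mul g x | g <- F] | `[< b y >]].
have [S [Sa lt]] : exists S : {fset G}, (forall x, x \in S -> a x) /\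
    (#|` neighbours (N (ball n)) S| < #|` S|)%N.
  apply: contrapT => nS; apply: noinj.
  have [|f [fN fI]] := @hall_rado G G a one (N (ball n)).
    move=> S Sa; rewrite leqNgt; apply/negP => lt; apply: nS.
    by exists S.
  exists (ball n), f; split.
  - by move=> x /fN; rewrite !inE => /andP[_ /asboolP].
  - by move=> x y /set_mem ax /set_mem ay; exact: fI.
  - by move=> x /fN; rewrite !inE => /andP[/mapP[g gF ->] _]; exists g.
pose T k : {fset G} := [fset x in [seq mul g h | g <- ball k, h <- S]].
have TP k x : reflect (exists g h, [/\ g \in ball k, h \in S & x = mul g h]) (x \in T k).
  rewrite inE; apply: (iffP allpairsP).
    by move=> [[g h] /= [? ? ?]]; exists g, h.
  by move=> [g [h [? ? ?]]]; exists (g, h).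
have T0 : T 0%N = S.
  apply/fsetP => x; apply/TP/idP => [[g [h []]]|xS].
    by rewrite inE => /eqP -> hS ->; rewrite m1.
  by exists one, x; rewrite inE eqxx m1.
have TS g k x : g \in E' -> x \in T k -> mul g x \in T k.+1.
  move=> gE /TP[h [s [hk sS ->]]]; apply/TP; exists (mul g h), s; split => //.
    by rewrite ballS; apply/allpairsP; exists (g, h).
have Tmono k : T k `<=` T k.+1.
  by apply/fsubsetP => x xT; rewrite -[x]m1; apply: TS; rewrite // inE eqxx.
have Tle k l : (k <= l)%N -> T k `<=` T l.
  move=> /subnK <-; elim: (l - k)%N => [|i IH]; first exact: fsubset_refl.
  by apply: fsubset_trans IH _; rewrite addSn.
have Tnb : fset_part (T n) b = neighbours (N (ball n)) S.
  apply/fsetP => x; apply/fset_partP/neighboursP.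
    move=> [/TP[g [h [gn hS ->]]] bx]; exists h => //; rewrite !inE; apply/andP.
    by split; [exact: map_f|exact/asboolP].
  move=> [h hS]; rewrite inE /= => /andP[/mapP[g gn ->] /asboolP bx]; split => //.
  by apply/TP; exists g, h.
have ltb : (#|` fset_part (T n) b| < #|` S|)%N by rewrite Tnb.
(* Each point of [T k] is moved into [b] by some element of [K], staying in [T n]; the point is
   recovered from that element and its image. *)
have leK k : (k < n)%N -> (#|` T k| <= size K * #|` fset_part (T n) b|)%N.
  move=> kn; have /choice[kap kapP] g : exists k, k \in K /\ b (mul k g).
    by have [i iK bi] := Kb g; exists i.
  pose phi x := (kap x, mul (kap x) x).
  have <- : #|` phi @` T k| = #|` T k|.
    rewrite card_in_imfset // => x y _ _ [-> ]; exact: (group_mulI groupG).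
  apply: (@leq_trans #|` [fset i in K] `*` fset_part (T n) b|); last first.
    by rewrite cardfsM leq_mul2r card_fseq size_undup orbT.
  apply: fsubset_leq_card; apply/fsubsetP => _ /imfsetP[x /= xT ->].
  have [kK bk] := kapP x; rewrite in_fsetM; apply/andP; split; first by rewrite inE.
  apply/fset_partP; split => //; apply: (fsubsetP (Tle k.+1 n kn)).
  by apply: TS => //; rewrite inE mem_cat kK orbT.
pose good k := forall g, g \in E ->
  (m * #|` fset_translate g (T k) `\` T k| <= #|` T k|)%N.
have [[k kn goodk]|nogood] := pselect (exists2 k, (k < n)%N & good k).
  (* All of [S] lies in [a], whereas [b] meets even the larger set [T n] in fewer points than [S]
     has. *)
  exists (T k); split => //.
  - rewrite -cardfs_gt0; apply: (@leq_trans #|` S|).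
      by apply: leq_ltn_trans ltb.
    by apply: fsubset_leq_card; rewrite -T0; exact: Tle.
  - apply: (@leq_trans #|` S|).
      apply: leq_trans (ltnW ltb); apply: fsubset_leq_card.
      apply/fsubsetP => x /fset_partP[xT bx]; apply/fset_partP; split => //.
      by apply: (fsubsetP (Tle k n (ltnW kn))).
    apply: fsubset_leq_card; apply/fsubsetP => x xS; apply/fset_partP; split.
      by apply: (fsubsetP (Tle 0%N k _)); rewrite // T0.
    exact: Sa.
(* Some [g] in [E] moves more than [#|T k| / m] points out of [T k]; they land in [T k.+1], and
   [T k] has at least [#|S|] points. *)
have grow k : (k < n)%N -> (m * #|` T k| + #|` S| <= m * #|` T k.+1|)%N.
  move=> kn; have : ~ good k by move=> gk; apply: nogood; exists k.
  move=> /existsNP[g /not_implyP[gE /negP]]; rewrite -ltnNge => big.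
  have sub : fset_translate g (T k) `\` T k `<=` T k.+1 `\` T k.
    apply/fsubsetP => _ /fsetDP[/imfsetP[x /= xT ->] nT]; apply/fsetDP; split => //.
    by apply: TS => //; rewrite inE mem_cat gE !orbT.
  have := fsubset_leq_card sub; rewrite (cardfsDS (Tmono k)) => le1.
  have := fsubset_leq_card (Tmono k).
  have := fsubset_leq_card (Tle 0%N k (leq0n _)); rewrite T0.
  have := leq_mul (leqnn m) le1; rewrite mulnBr. lia.
have growk k : (k <= n)%N -> (m * #|` S| + k * #|` S| <= m * #|` T k|)%N.
  elim: k => [|k IH] kn; first by rewrite T0 mul0n addn0.
  by have := IH (ltnW kn); have := grow _ kn; rewrite mulSn; lia.
have := growk (m * size K)%N (leqnSn _).
have := leK (m * size K)%N (ltnSn _).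
move: ltb; set s := #|` S|; set u := #|` _|; set v := #|` _| => ltb le1 le2.
have := leq_mul (leqnn m) le1.
have : (size K * u <= size K * s)%N by rewrite leq_mul2l ltnW ?orbT.
move=> h1 h2; have := leq_mul (leqnn m) h1; nia.
Qed.

End Folner.

(** * Invariant means as ultralimits of frequencies *)

Local Open Scope ring_scope.

Lemma ultra_bounded_cvg (R : realType) (I : Type) (U : set_system I)
    (u : I -> R) (a b : R) : UltraFilter U ->
  (forall i, a <= u i <= b) -> cvg (u @ U).
Proof.
move=> UU uab.
have [|p [_ clp]] := @segment_compact R a b (u @ U) _.
  by apply: (filterE (F := U)) => i /=; rewrite in_itv /= uab.
apply/cvg_ex; exists p => A nA.
have [//|nUA] := in_ultra_setVsetC (u @^-1` A) UU.
by have [||x [nAx Ax]] := clp (~` A) A.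
Qed.

Section Mean.
Variables (G : countType) (mul : G -> G -> G) (one : G) (inv : G -> G).
Variable R : realType.
Hypothesis groupG : is_group mul one inv.

Definition is_invariant_mean (m : set G -> R) :=
  [/\ forall S, 0 <= m S, m setT = 1,
      forall S S', S `&` S' = set0 -> m (S `|` S') = m S + m S' &
      forall g S, m [set h | S (mul g h)] = m S].

Definition frequency (T : {fset G}) (S : set G) : R :=
  #|` fset_part T S|%:R / #|` T|%:R.

Lemma frequency_itv T S : 0 <= frequency T S <= 1.
Proof.
have le : (#|` fset_part T S| <= #|` T|)%N.
  by apply: fsubset_leq_card; apply/fsubsetP => x /fset_partP[].
rewrite /frequency divr_ge0//=; have [->|T0] := posnP #|` T|%fset.
  by rewrite invr0 mulr0 ler01.
by rewrite ler_pdivrMr ?ltr0n// mul1r ler_nat.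
Qed.

Lemma frequencyT T : T != fset0 -> frequency T setT = 1.
Proof.
rewrite -cardfs_gt0 => T0.
have -> : frequency T setT = #|` T|%:R / #|` T|%:R.
  congr (#|` _|%:R / _); apply/fsetP => x; apply/fset_partP/idP => [[]//|xT].
  by split.
by rewrite divff// pnatr_eq0 -lt0n.
Qed.

Lemma frequencyU T S S' : S `&` S' = set0 ->
  frequency T (S `|` S') = frequency T S + frequency T S'.
Proof.
move=> SS'; rewrite /frequency -mulrDl -natrD -cardfsUI.
have -> : (fset_part T S `&` fset_part T S' = fset0)%fset.
  apply/fsetP => x; rewrite in_fset0; apply/negP => /fsetIP.
  by move=> [/fset_partP[_ Sx] /fset_partP[_ S'x]]; have : (S `&` S') x by []; rewrite SS'.
rewrite cardfs0 addn0; congr (#|` _|%:R / _); apply/fsetP => x.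
apply/fset_partP/fsetUP => [[xT [Sx|Sx]]|[] /fset_partP[xT Sx]].
- by left; apply/fset_partP.
- by right; apply/fset_partP.
- by split => //; left.
- by split => //; right.
Qed.

(** Translating by [g] the points of [T] that [g] moves into [S] gives points of [S] in [T], up to
    those in the small set by which the translate of [T] leaves [T]. *)
Lemma frequency_translate T S g (m : nat) :
  (m.+1 * #|` fset_translate mul g T `\` T| <= #|` T|)%fset%N ->
  frequency T [set h | S (mul g h)] <= frequency T S + m.+1%:R^-1.
Proof.
move=> small; have [T0|T0] := posnP #|` T|%fset.
  by rewrite /frequency T0 invr0 !mulr0 add0r invr_ge0.
set d := #|` _| in small.
have le : (#|` fset_part T [set h | S (mul g h)]| <= #|` fset_part T S| + d)%N.
  apply: (@leq_trans #|` (fset_part T S `|` fset_translate mul g T `\` T)%fset|).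
    pose P := fset_part T [set h | S (mul g h)].
    have <- : #|` fset_translate mul g P|%fset = #|` P|.
      by rewrite card_imfset//; exact: (group_mulI groupG).
    apply: fsubset_leq_card; apply/fsubsetP => _ /imfsetP[x /= /fset_partP[xT Sx] ->].
    rewrite in_fsetU in_fsetD; have [gxT|gxT] /= := boolP (mul g x \in T).
      by apply/orP; left; apply/fset_partP.
    by apply/orP; right; apply/imfsetP; exists x.
  by rewrite cardfsU leq_subr.
apply: (@le_trans _ _ (frequency T S + d%:R / #|` T|%:R)).
  by rewrite /frequency -mulrDl -natrD ler_wpM2r ?invr_ge0// ler_nat.
rewrite lerD2l ler_pdivrMr ?ltr0n// ler_pdivlMl ?ltr0n//.
by rewrite -natrM ler_nat.
Qed.

Lemma exists_invariant_mean (T : nat -> {fset G}) (a b : set G) :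
  (forall n, T n != fset0) ->
  (forall n, (#|` fset_part (T n) b| <= #|` fset_part (T n) a|)%N) ->
  (forall g, exists N, forall n, (N <= n)%N ->
    (n.+1 * #|` fset_translate mul g (T n) `\` T n| <= #|` T n|)%fset%N) ->
  exists m, is_invariant_mean m /\ m b <= m a.
Proof.
move=> T0 Tba Tinv.
(* The ultrafilter refines [\oo], so properties holding for all large [n] pass to the limit. *)
have [U [UU oU]] := @ultraFilterLemma nat \oo _.
pose m S := lim ((fun n => frequency (T n) S) @ U).
have mcvg S : (fun n => frequency (T n) S) @ U --> m S.
  by apply: (ultra_bounded_cvg UU (a := 0) (b := 1)) => n; exact: frequency_itv.
have UE P : (forall n, P n) -> \forall n \near U, P n by move=> h; apply: filterE.
(* One inequality is enough: applied to [inv g] and the translated set it gives the converse. *)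
have le_inv g S : m [set h | S (mul g h)] <= m S.
  have h : (fun n => frequency (T n) S + n.+1%:R^-1 - 
      frequency (T n) [set h | S (mul g h)]) @ U --> m S + 0 - m [set h | S (mul g h)].
    apply: cvgB => //; apply: cvgD => //.
    apply: cvg_trans cvg_harmonic.
    exact: (cvg_app _ oU).
  rewrite -subr_ge0 -[m S]addr0; apply: (cvgr_to_ge h).
  have [N NT] := Tinv g; apply: oU; exists N => // n /= Nn.
  by rewrite subr_ge0; exact/frequency_translate/NT.
exists m; split; first split.
- by move=> S; apply: (cvgr_to_ge (mcvg S)); apply: UE => n; case/andP: (frequency_itv (T n) S).
- apply/eqP; rewrite eq_le; apply/andP; split.
    by apply: (cvgr_to_le (mcvg _)); apply: UE => n; rewrite frequencyT.
  by apply: (cvgr_to_ge (mcvg _)); apply: UE => n; rewrite frequencyT.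
- move=> S S' SS'; apply: (cvg_unique _ (mcvg _)); first exact: Rhausdorff.
  have -> : (fun n => frequency (T n) (S `|` S')) =
      (fun n => frequency (T n) S + frequency (T n) S').
    by apply/funext => n; rewrite frequencyU.
  exact: cvgD.
- move=> g S; apply/eqP; rewrite eq_le le_inv /=.
  have := le_inv (inv g) [set h | S (mul g h)]; congr (m _ <= _).
  by apply/seteqP; split=> h /=; rewrite (group_mulVK groupG).
- rewrite -subr_ge0; apply: (cvgr_to_ge (cvgB (mcvg a) (mcvg b))); apply: UE => n.
  by rewrite subr_ge0 /frequency ler_wpM2r ?invr_ge0// ler_nat.
Qed.

End Mean.

(** * Radon extension of a content on clopen sets *)

Lemma clopen_bigsetU (T : topologicalType) (I : Type) (r : seq I) (P : pred I)
    (F : I -> set T) : (forall i, P i -> clopen (F i)) ->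
  clopen (\big[setU/set0]_(i <- r | P i) F i).
Proof.
by move=> cF; elim/big_ind : _ => //; [exact: clopen0|move=> *; exact: clopenU].
Qed.

Section RadonExtension.
Variables (X : ptopologicalType) (R : realType) (m : set X -> R).
Hypothesis compactX : compact [set: X].
Hypothesis hausdorffX : hausdorff_space X.
Hypothesis zerodimX : zero_dimensional X.
Hypothesis m_ge0 : forall A, clopen A -> 0 <= m A.
Hypothesis mT : m setT = 1.
Hypothesis mU : forall A B, clopen A -> clopen B -> A `&` B = set0 ->
  m (A `|` B) = m A + m B.

Let m0 : m set0 = 0.
Proof.
have := mU clopen0 clopen0 (setI0 _).
by rewrite setU0 => /eqP; rewrite -subr_eq subrr => /eqP.
Qed.

Let le_m A B : clopen A -> clopen B -> A `<=` B -> m A <= m B.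
Proof.
move=> cA cB AB; rewrite -(setDUK AB) mU ?setDIK//; last exact: clopenD.
by rewrite lerDl; apply: m_ge0; exact: clopenD.
Qed.

Let m_subU A B : clopen A -> clopen B -> m (A `|` B) <= m A + m B.
Proof.
move=> cA cB.
have -> : A `|` B = A `|` (B `\` A).
  apply/seteqP; split=> x [Ax|Bx]; [by left| |by left|by right; case: Bx].
  by have [Ax|nAx] := pselect (A x); [left|right].
rewrite mU ?setDIK//; last exact: clopenD.
by rewrite lerD2l; apply: le_m => //; exact: clopenD.
Qed.

Let m_bigsetU (F : nat -> set X) n : (forall i, clopen (F i)) ->
  m (\big[setU/set0]_(i < n) F i) <= \sum_(i < n) m (F i).
Proof.
move=> cF; elim: n => [|n IH]; first by rewrite !big_ord0 m0.
rewrite !big_ord_recr /=; apply: le_trans (m_subU _ _) _ => //.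
  by apply: clopen_bigsetU.
by rewrite lerD2r.
Qed.

(** By zero-dimensionality and compactness, finitely many clopen sets, each inside some [U n], cover
    [C]; [D n] collects those assigned to [n]. *)
Let clopen_split (C : set X) (U : nat -> set X) :
  clopen C -> (forall n, open (U n)) -> C `<=` \bigcup_n U n ->
  exists N (D : nat -> set X), (forall n, clopen (D n) /\ D n `<=` U n) /\
    C `<=` \big[setU/set0]_(i < N) D i.
Proof.
move=> [oC cC] oU CU.
have : compact C := subclosed_compact cC compactX (@subsetT _ _).
rewrite compact_cover => /(_ (nat * set X)%type
  [set p | clopen p.2 /\ p.2 `<=` U p.1] snd) [].
- by move=> p [[]].
- move=> x /CU[n _ Unx].
  have [D [Dx cD] DU] : filter_from [set D : set X | D x /\ clopen D] id (U n).
    apply: zero_dimensional_cvg => //; exact: open_nbhs_nbhs.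
  by exists (n, D).
move=> D' /= D'D CD'.
have D'P p : p \in D' -> clopen p.2 /\ p.2 `<=` U p.1 by move=> /D'D/set_mem.
pose D n := \big[setU/set0]_(p <- D' | (p.1 == n) && (p \in D')) p.2.
exists (\max_(p <- D') p.1).+1%N, D.
split.
  move=> n; split.
    by apply: clopen_bigsetU => p /andP[_ /D'P[]].
  rewrite /D -bigcup_seq_cond => x [p /= /and3P[_ /eqP <- /D'P[_]]]; exact.
move=> x /CD'[p /= pD' px]; rewrite -(bigcup_mkord _ D); exists p.1 => /=.
  by rewrite ltnS; exact: (leq_bigmax_seq (F := fst)).
by rewrite /D -bigcup_seq_cond; exists p => //=; rewrite pD' eqxx.
Qed.

Local Open Scope ereal_scope.

(** The content is extended to open sets from inside by clopen sets; [outer_content] then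
    approximates arbitrary sets from outside by open ones. *)
Definition inner_content (U : set X) : \bar R :=
  ereal_sup [set (m C)%:E | C in [set C | clopen C /\ C `<=` U]].

Definition outer_content (A : set X) : \bar R :=
  ereal_inf [set inner_content U | U in [set U | open U /\ A `<=` U]].

Local Notation inner := inner_content.
Local Notation outer := outer_content.

Let le_inner U V : U `<=` V -> inner U <= inner V.
Proof.
move=> UV; apply: ereal_sup_le => _ [C [cC CU] <-]; exists C => //.
by split => //; exact: subset_trans UV.
Qed.

Let inner_clopen C : clopen C -> inner C = (m C)%:E.
Proof.
move=> cC; apply/eqP; rewrite eq_le; apply/andP; split.
  by apply: ge_ereal_sup => _ [D [cD DC] <-]; rewrite lee_fin le_m.
by apply: ereal_sup_ubound; exists C => //; split.
Qed.

Let inner_ge C U : clopen C -> C `<=` U -> (m C)%:E <= inner U.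
Proof. by move=> cC CU; apply: ereal_sup_ubound; exists C. Qed.

Let inner_ge0 U : 0 <= inner U.
Proof. by have := inner_ge clopen0 (@sub0set _ U); rewrite m0. Qed.

(** Compactness reduces countable subadditivity on open sets to finite subadditivity on clopen sets,
    through [clopen_split]. *)
Let inner_bigcup (U : nat -> set X) : (forall n, open (U n)) ->
  inner (\bigcup_n U n) <= \sum_(n <oo) inner (U n).
Proof.
move=> oU; apply: ge_ereal_sup => _ [C [cC CU] <-].
have [N [D [DP CD]]] := clopen_split cC oU CU.
apply: (@le_trans _ _ (\sum_(0 <= i < N) inner (U i))); last first.
  by apply: nneseries_lim_ge => n _ _; exact: inner_ge0.
apply: (@le_trans _ _ (\sum_(i < N) m (D i))%:E).
  rewrite lee_fin; apply: (@le_trans _ _ (m (\big[setU/set0]_(i < N) D i))).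
    by apply: le_m => //; apply: clopen_bigsetU => i _; exact: (DP i).1.
  by apply: m_bigsetU => i; exact: (DP i).1.
rewrite -sumEFin big_mkord; apply: lee_sum => i _.
by apply: inner_ge; have [] := DP i.
Qed.

Let outer_le A U : open U -> A `<=` U -> outer A <= inner U.
Proof. by move=> oU AU; apply: ereal_inf_lbound; exists U. Qed.

Let outer_open U : open U -> outer U = inner U.
Proof.
move=> oU; apply/eqP; rewrite eq_le outer_le//=.
by apply: le_ereal_inf_tmp => _ [V [_ UV] <-]; exact: le_inner.
Qed.

Let outer_ge0 A : 0 <= outer A.
Proof. by apply: le_ereal_inf_tmp => _ [U _ <-]; exact: inner_ge0. Qed.

Let outer0 : outer set0 = 0.
Proof. by rewrite outer_open; [rewrite inner_clopen ?m0//; exact: clopen0|exact: open0]. Qed.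

Let outerT : outer setT = 1.
Proof. by rewrite outer_open; [rewrite inner_clopen ?mT//; exact: clopenT|exact: openT]. Qed.

Let le_outer : {homo outer : A B / A `<=` B >-> A <= B}.
Proof.
move=> A B AB; apply: ereal_inf_le_tmp => _ [U [oU BU] <-]; exists U => //.
by split => //; exact: subset_trans BU.
Qed.

Let outer_fin A : outer A \is a fin_num.
Proof.
rewrite ge0_fin_numE//; apply: (@le_lt_trans _ _ 1); last exact: ltry.
by rewrite -outerT; exact: le_outer.
Qed.

Let outer_sigma_subadditive : sigma_subadditive outer.
Proof.
move=> F; apply/lee_addgt0Pr => e e0.
apply: le_trans (epsilon_trick xpredT (fun n => outer_ge0 (F n)) (ltW e0)).
have /choice[U UP] n : exists U, [/\ open U, F n `<=` U &
    inner U <= outer (F n) + (e / (2 ^ n.+1)%:R)%:E].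
  have en0 : (0 < e / (2 ^ n.+1)%:R :> R)%R.
    by rewrite divr_gt0// ltr0n expn_gt0.
  have [_ [U [oU FU] <-] /ltW] := lb_ereal_inf_adherent en0 (outer_fin (F n)).
  by exists U.
apply: (@le_trans _ _ (inner (\bigcup_n U n))).
  apply: outer_le; first by apply: bigcup_open => n _; have [] := UP n.
  by apply: subset_bigcup => n _; have [] := UP n.
apply: le_trans (inner_bigcup _) _; first by move=> n; have [] := UP n.
by apply: lee_nneseries => [n _ _|n _]; [exact: inner_ge0|have [] := UP n].
Qed.

Let mu : {outer_measure set X -> \bar R} :=
  HB.pack outer (isOuterMeasure.Build R X outer outer0 outer_ge0 le_outer
    outer_sigma_subadditive).

(** For open [V] containing [E], take [C] clopen in the part of [V] inside [U] and [D] clopen in [V]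
    minus [C]. They are disjoint subsets of [V], so their contents add up to at most [inner V]; take
    suprema over [D], then over [C]. *)
Let open_caratheodory U : open U -> mu.-caratheodory U.
Proof.
move=> oU; apply: le_caratheodory_measurable => E.
apply: le_ereal_inf_tmp => _ [V [oV EV] <-].
rewrite -leeBrDr; last exact: outer_fin.
apply: (@le_trans _ _ (inner (V `&` U))).
  by apply: outer_le; [exact: openI|exact: setSI].
apply: ge_ereal_sup => _ [C [cC CVU] <-].
rewrite leeBrDr; last exact: outer_fin.
rewrite addeC -leeBrDr//.
apply: (@le_trans _ _ (inner (V `\` C))).
  apply: outer_le; first by rewrite setDE; apply: openI => //; apply: closed_openC; case: cC.
  by move=> x [Ex nUx]; split; [exact: EV|move=> /CVU[]].
apply: ge_ereal_sup => _ [D [cD DVC] <-].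
rewrite leeBrDr// -EFinD -mU//.
  apply: inner_ge; first exact: clopenU.
  by move=> x [/DVC[]//|/CVU[]].
by apply/seteqP; split=> // x [/DVC[_ nCx]].
Qed.

Let borel_caratheodory : (@measurable _ (borelT X)) `<=` mu.-caratheodory.
Proof.
apply: smallest_sub; last by move=> U; exact: open_caratheodory.
split.
- exact: caratheodory_measurable_set0.
- by move=> A cA; rewrite setTD; exact: caratheodory_measurable_setC.
- by move=> F cF; exact: caratheodory_measurable_bigcup.
Qed.

Let mu_sigma_additive : semi_sigma_additive (outer : set (borelT X) -> \bar R).
Proof.
move=> F mF tF mUF.
exact: (@caratheodory_measure_sigma_additive R X mu F
  (fun n => borel_caratheodory (mF n)) tF (borel_caratheodory mUF)).
Qed.

Let borel_measure : {measure set (borelT X) -> \bar R} :=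
  HB.pack (outer : set (borelT X) -> \bar R)
    (isMeasure.Build _ (borelT X) R outer outer0 outer_ge0 mu_sigma_additive).

Let P : probability (borelT X) R :=
  HB.pack (outer : set (borelT X) -> \bar R) (Measure.class borel_measure)
   (Measure_isProbability.Build _ _ _ borel_measure outerT).

Let PE B : P B = outer B. Proof. by []. Qed.

(** Outer regularity holds by construction. Inner regularity of [B] is outer regularity of its
    complement, as complements of open sets are compact. *)
Let P_radon : radon P.
Proof.
move=> B mB; split; last first.
  rewrite PE; congr ereal_inf; apply/seteqP; split=> _ [U [oU BU] <-]; exists U => //.
    by rewrite PE outer_open.
  by rewrite PE outer_open.
set s := ereal_sup _.
have sP : s <= P B.
  by apply: ge_ereal_sup => _ [K [_ KB] <-]; exact: le_outer.
apply/eqP; rewrite eq_le sP andbT.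
have s0 : 0 <= s.
  rewrite -outer0; apply: ereal_sup_ubound; exists set0 => //.
  by split; [exact: compact0|exact: sub0set].
have sfin : s \is a fin_num.
  by rewrite ge0_fin_numE//; apply: (le_lt_trans sP); rewrite -ge0_fin_numE//; exact: outer_fin.
rewrite -[B]setCK probability_setC; last exact: measurableC.
rewrite leeBlDr; last exact: outer_fin.
rewrite addeC -leeBlDr//.
apply: le_ereal_inf_tmp => _ [U [oU BU] <-].
rewrite leeBlDr// -outer_open//.
have mU' : measurable (U : set (borelT X)) by exact: sub_sigma_algebra.
rewrite addeC -leeBlDr; last exact: outer_fin.
rewrite -(probability_setC P mU'); apply: ereal_sup_ubound; exists (~` U) => //.
split; last by rewrite -[B]setCK; exact: subsetC.
by apply: (subclosed_compact _ compactX) => //; exact: open_closedC.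
Qed.

(** The last clause transfers invariance from clopen sets to [P]: one inequality is proved through
    open supersets, then used for both [h] and its inverse. *)
Lemma radon_extension : exists P : probability (borelT X) R,
  [/\ radon P, forall A, clopen A -> P A = (m A)%:E &
    forall h h' : X -> X, continuous h -> continuous h' ->
      cancel h h' -> cancel h' h ->
      (forall C, clopen C -> m (h @^-1` C) = m C) ->
      forall B, P (h @^-1` B) = P B].
Proof.
exists P; split; first exact: P_radon.
  by move=> A cA; rewrite PE outer_open ?inner_clopen//; case: cA.
suff le h h' : continuous h -> continuous h' -> cancel h h' -> cancel h' h ->
    (forall C, clopen C -> m (h @^-1` C) = m C) ->
    forall B, outer (h @^-1` B) <= outer B.
  move=> h h' ch ch' hK h'K mh B; apply/eqP; rewrite eq_le (le h h')//=.
  have {1}-> : B = h' @^-1` (h @^-1` B).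
    by apply/seteqP; split=> x /=; rewrite h'K.
  apply: (le h' h) => // C cC.
  rewrite -(mh (h' @^-1` C)); last exact: preimage_clopen.
  by congr m; apply/seteqP; split=> x /=; rewrite hK.
move=> ch ch' hK h'K mh B; apply: le_ereal_inf_tmp => _ [U [oU BU] <-].
apply: (@le_trans _ _ (inner (h @^-1` U))).
  by apply: outer_le; [apply: open_comp => // x _; exact: ch|exact: preimage_subset].
apply: ge_ereal_sup => _ [C [cC CU] <-].
have hC : h @^-1` (h' @^-1` C) = C by apply/seteqP; split=> x /=; rewrite hK.
rewrite -hC mh; last exact: preimage_clopen.
apply: inner_ge; first exact: preimage_clopen.
by move=> x /= /CU /=; rewrite h'K.
Qed.

End RadonExtension.

(** * Dynamical comparison *)

(** The points whose orbit misses [B] form a proper closed invariant set, empty by minimality. So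
    the preimages of [B] cover [X], and compactness leaves finitely many. *)
Lemma minimal_return_syndetic (G : countType) (mul : G -> G -> G) (one : G)
    (inv : G -> G) (X : ptopologicalType) (act : G -> X -> X) (B : set X) x0 :
  is_group mul one inv -> minimal_flow mul one act -> open B -> B !=set0 ->
  exists K : seq G, forall g, exists2 k, k \in K & B (act (mul k g) x0).
Proof.
move=> groupG [[[actC act1 actM] cX hX] _ Xmin] oB [y By].
have opB k : open (act k @^-1` B).
  by apply: open_comp => // x _; exact: actC.
have cov : [set: X] `<=` \bigcup_k (act k @^-1` B).
  apply: contrapT => ncov.
  have : ~` (\bigcup_k (act k @^-1` B)) = setT.
    apply: Xmin.
    - by apply: open_closedC; apply: bigcup_open.
    - move=> g _ [x nx <-] [k _ kx]; apply: nx; exists (mul k g) => //.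
      by rewrite /= actM.
    - apply: contrapT => n0; apply: ncov => x _; apply: contrapT => nx.
      by apply: n0; exists x.
  by move=> /seteqP[_ /(_ y I)]; apply; exists one => //=; rewrite act1.
move: cX; rewrite compact_cover => /(_ G setT (fun k => act k @^-1` B)) [|//|K _ KB].
  by move=> k _; exact: opB.
exists (K : seq G) => g; have [k kK kB] := KB (act g x0) I.
by exists k => //; rewrite actM.
Qed.

Lemma invariant_radon_measure (G : countType) (mul : G -> G -> G) (one : G)
    (inv : G -> G) (X : ptopologicalType) (act : G -> X -> X) (R : realType)
    (m : set G -> R) (x0 : X) :
  is_group mul one inv -> ch_flow mul one act -> zero_dimensional X ->
  is_invariant_mean mul m ->
  exists P : probability (borelT X) R, [/\ radon P, invariant_measure act P &
    forall A, clopen A -> P A = (m [set g | A (act g x0)])%:E].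
Proof.
move=> groupG [[actC act1 actM] cX hX] zX [mge0 mT mU minv].
have [_ _ mV] := groupG.
have [|||P [Prad PE Pinv]] :=
    @radon_extension X R (fun A => m [set g | A (act g x0)]) cX hX zX.
- by move=> A _; exact: mge0.
- exact: mT.
- move=> A B _ _ AB; rewrite -mU//; apply/seteqP; split=> // g [Ag Bg].
  by have : (A `&` B) (act g x0) by []; rewrite AB.
exists P; split => // g B _; apply: (Pinv (act g) (act (inv g))) => //.
- by move=> x; rewrite -actM mV act1.
- by move=> x; rewrite -actM (group_mulgV groupG) act1.
- move=> C _; rewrite -[RHS](minv g); congr m.
  by apply/seteqP; split=> h /=; rewrite actM.
Qed.

Lemma no_bd_inj_mean (G : countType) (mul : G -> G -> G) (one : G) (inv : G -> G)
    (R : realType) (a b : set G) (K : seq G) :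
  is_group mul one inv -> (forall g, exists2 k, k \in K & b (mul k g)) ->
  ~ bd_inj mul id id a b ->
  exists m : set G -> R, is_invariant_mean mul m /\ m b <= m a.
Proof.
move=> groupG Kb noinj.
(* At stage [n] the translations are the elements of [G] with code below [n], so each element is
   controlled from some stage on, with precision [n.+1]. *)
have /choice[T TP] (n : nat) := no_bd_inj_folner groupG (pmap choice.unpickle (iota 0 n))
  (ltn0Sn n) Kb noinj.
apply: (@exists_invariant_mean _ _ _ _ R groupG T a b).
- by move=> n; have [] := TP n.
- by move=> n; have [] := TP n.
move=> g; exists (choice.pickle g).+1 => n gn; have [_ _] := TP n; apply.
rewrite mem_pmap; apply/mapP; exists (choice.pickle g); last by rewrite choice.pickleK.
by rewrite mem_iota.
Qed.

Theorem theoremt (Gam : countType) (mul : Gam -> Gam -> Gam) (one : Gam)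
    (inv : Gam -> Gam) (X : ptopologicalType) (act : Gam -> X -> X)
    (R : realType) :
  is_group mul one inv ->
  universal_minimal_flow mul one act ->
  [/\ unperforated act, tle_partial_order act & dynamical_comparison R act].
Proof.
move=> groupG umf; have [minX _] := umf; have [chX _ _] := minX.
have [actionX cX hX] := chX.
have [Phi [Phi_clopen PhiT PhiI PhiC Phi_act]] := ultra_coding groupG umf.
have [x0 [Phi_orbit zX]] := orbit_retraction minX Phi_clopen PhiT PhiI PhiC Phi_act.
have lift A B : bclopen A -> bclopen B ->
    bd_inj mul fst fst (orbit_trace act x0 A) (orbit_trace act x0 B) -> tle act A B.
  exact: (tle_traceP groupG actionX Phi_clopen PhiT PhiI PhiC Phi_act Phi_orbit).
split.
- move=> n A B nA nB n0 bA bB sA sB AB; apply: lift => //.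
  apply: (bd_inj_cancel one n0).
    exact/orbit_trace_bounded/bB.2.
  have trA := tnsum_trace x0 groupG actionX sA.
  have trB := tnsum_trace x0 groupG actionX sB.
  (* From [n] copies of the trace of [A] pass to the trace of [nA], into that of [nB], and back to
     [n] copies of the trace of [B]. *)
  apply: (bd_inj_trans groupG (bd_bij_inj trA)).
  apply: (bd_inj_trans groupG (tle_trace x0 groupG actionX AB)).
  exact: (bd_bij_inj (bd_bij_sym groupG (0%N, (one, 0%N)) trB)).
- exact: (tle_is_partial_order groupG actionX Phi_clopen PhiT PhiI PhiC Phi_act Phi_orbit).
move=> A B clA clB A0 B0 lt_mu.
have bcl C : clopen C -> bclopen (C `*` [set 0%N]).
  move=> clC; split; last by exists 1%N => x n [_ /= ->].
  move=> [|n].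
    have -> // : [set x | (C `*` [set 0%N]) (x, 0%N)] = C.
    by apply/seteqP; split=> [x []|].
  have -> : [set x | (C `*` [set 0%N]) (x, n.+1)] = set0; last exact: clopen0.
  by apply/seteqP; split=> [x []|].
(* Both sets live on level zero, so an injection between their traces in the group suffices. *)
have [[F [f [fab fI fd]]]|noinj] := pselect (bd_inj mul id id
    [set g | A (act g x0)] [set g | B (act g x0)]).
  apply: lift; [exact: bcl|exact: bcl|].
  exists F, (fun p => (f p.1, p.2)); split.
  - by move=> [g k] [/= Ag k0]; split => //; exact: fab.
  - move=> [g k] [h l] /set_mem[/= Ag _] /set_mem[/= Ah _] [e ->].
    by congr pair; apply: fI => //; exact: mem_set.
  - by move=> [g k] [/= Ag _]; exact: fd.
(* Without an injection there is an invariant Radon probability giving [B] at most the mass of [A],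
   against the assumption. *)
have [K KB] := minimal_return_syndetic x0 groupG minX clB.1 B0.
have [m [minv le_m]] := no_bd_inj_mean R groupG KB noinj.
have [P [Prad Pinv PE]] := invariant_radon_measure x0 groupG chX zX minv.
have := lt_mu P Prad Pinv; rewrite !PE// lte_fin ltNge.
by rewrite le_m.
Qed.
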